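(* Let $L$ be a differential operator on $\mathcal{S}'$ (with real constant coefficients) whose distributional Fourier transform $\hat{l}$ is positive on $\mathbb{R}^d$ and satisfies $\hat{l}^{-1}\in L_1(\mathbb{R}^d)$. Let $G:\mathbb{R}^d\to\mathbb{R}$ be a continuous, real-valued function with $G\in L_1(\mathbb{R}^d)$ which is a Green function with respect to $L$, i.e. $LG=\delta_0$ in $\mathcal{S}'$. If $G$ is an even function, then $G$ is a positive definite function, and $$\hat{\mathcal{G}}(\mathbf{x}):=(2\pi)^{-d/2}\,\hat{l}(\mathbf{x})^{-1},\qquad \mathbf{x}\in\mathbb{R}^d,$$ is the $L_1(\mathbb{R}^d)$-Fourier transform of $G$.
   Context: $\mathcal{S}$ is the Schwartz space on $\mathbb{R}^d$ and $\mathcal{S}'$ the space of tempered distributions, with pairing $\langle T,\gamma\rangle=T(\gamma)$. A continuous $L_1$ function $f$ is identified with the tempered distribution $\gamma\mapsto\int_{\mathbb{R}^d} f(\mathbf{x})\gamma(\mathbf{x})\,d\mathbf{x}$. $\delta_0$ is the Dirac distribution at the origin, $\langle\delta_0,\gamma\rangle=\gamma(0)$. A differential operator (with real-valued constant coefficients) is a map $P:\mathcal{S}'\to\mathcal{S}'$ of the form $P=\sum_{|\alpha|\le m}c_\alpha D^\alpha$ with $c_\alpha\in\mathbb{R}$, $\alpha\in\mathbb{N}_0^d$, $m\in\mathbb{N}_0$, where $D^\alpha$ is the distributional derivative $\langle D^\alpha T,\gamma\rangle=(-1)^{|\alpha|}\langle T,D^\alpha\gamma\rangle$. Its distributional Fourier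 transform is the polynomial $\hat{p}(\mathbf{x})=\sum_{|\alpha|\le m}c_\alpha (i\mathbf{x})^\alpha$; it satisfies $\widehat{PT}=\hat{p}\,\hat{T}$ for all $T\in\mathcal{S}'$. A Green function (full-space) with respect to a differential operator $L$ is $G\in\mathcal{S}'$ with $LG=\delta_0$. Fourier transform convention: $\hat{f}(\mathbf{x})=(2\pi)^{-d/2}\int_{\mathbb{R}^d}f(\mathbf{y})e^{-i\mathbf{x}^T\mathbf{y}}\,d\mathbf{y}$. A continuous even function $\Phi:\mathbb{R}^d\to\mathbb{R}$ is called positive definite if, for all $N\in\mathbb{N}$, all pairwise distinct $\mathbf{x}_1,\dots,\mathbf{x}_N\in\mathbb{R}^d$ and all $(c_1,\dots,c_N)^T\in\mathbb{R}^N\setminus\{0\}$, one has $\sum_{j=1}^N\sum_{k=1}^N c_jc_k\Phi(\mathbf{x}_j-\mathbf{x}_k)>0$ (strict inequality). *)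

(* Defs.v *)
From HB Require Import structures.
From mathcomp Require Import all_boot all_order all_algebra.
From mathcomp Require Import all_classical all_reals all_analysis complex ring lra.

Set Implicit Arguments.
Unset Strict Implicit.
Unset Printing Implicit Defensive.
Import Order.TTheory GRing.Theory Num.Theory.
Import numFieldNormedType.Exports.

Local Open Scope classical_set_scope.
Local Open Scope ring_scope.

(* 'rV[R]_n carries the Borel sigma-algebra of its (max-norm) topology. *)
Section borel_rV.
Variables (R : realType) (n : nat).
Let borel := g_sigma_algebraType (@open 'rV[R]_n).

HB.instance Definition _ :=
  @isMeasurable.Build (sigma_display (@open 'rV[R]_n)) 'rV[R]_n
    (@measurable _ borel) measurable0 (@measurableC _ borel)
    (@bigcupT_measurable _ borel).

End borel_rV.

Section lebesgue_rV.
Variable R : realType.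

Lemma open_measurable_rV n (A : set 'rV[R]_n) : open A -> measurable A.
Proof. exact: sub_sigma_algebra. Qed.

Lemma continuous_measurable_rV n (f : 'rV[R]_n -> R) :
  continuous f -> measurable_fun setT f.
Proof.
move=> /continuousP cf; apply: (measurability (@measurable_realfun.RGenOpens.G R)).
  exact: measurable_realfun.RGenOpens.measurableE.
move=> _ [_ [x [y ->]] <-]; rewrite setTI.
by apply: open_measurable_rV; apply: cf; exact: interval_open.
Qed.

Definition rV_cons n (xy : R * 'rV[R]_n) : 'rV[R]_n.+1 :=
  row_mx (xy.1)%:M xy.2.

Lemma rV_consE0 n (xy : R * 'rV[R]_n) : rV_cons xy 0 0 = xy.1.
Proof.
transitivity (row_mx (xy.1)%:M xy.2 0 (lshift n (0 : 'I_1))).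
  by congr (row_mx _ _ _ _); exact/val_inj.
by rewrite row_mxEl mxE.
Qed.

Lemma rV_consES n (xy : R * 'rV[R]_n) (i : 'I_n) :
  rV_cons xy 0 (lift 0 i) = xy.2 0 i.
Proof.
transitivity (row_mx (xy.1)%:M xy.2 0 (rshift 1 i)); last by rewrite row_mxEr.
by congr (row_mx _ _ _ _); apply/val_inj.
Qed.

Lemma ball_rV_cons n (x : R) (u : 'rV[R]_n) e (y : R) (v : 'rV[R]_n) : 0 < e ->
  ball (rV_cons (x, u)) e (rV_cons (y, v)) <-> ball x e y /\ ball u e v.
Proof.
move=> e0; split=> [[_ H]|[H1 [_ H2]]].
  split; first by have := H 0 0; rewrite !rV_consE0.
  split=> // i j; rewrite (ord1 i).
  by have := H 0 (lift 0 j); rewrite !rV_consES.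
split=> // i j; rewrite (ord1 i).
case: (unliftP 0 j) => [k|] ->; first by rewrite !rV_consES.
by rewrite !rV_consE0.
Qed.

Lemma measurable_rV_cons n : measurable_fun setT
  (@rV_cons n : measurableTypeR R * 'rV[R]_n -> 'rV[R]_n.+1).
Proof.
apply: (@measurability _ _ _ _ setT _ (@open 'rV[R]_n.+1)) => //.
move=> _ [U oU <-]; rewrite setTI.
pose B (z : rat * 'rV[rat]_n * nat) : set (R * 'rV[R]_n) :=
  ball (ratr z.1.1 : R) (z.2.+1%:R^-1) `*`
  ball (map_mx ratr z.1.2 : 'rV[R]_n) (z.2.+1%:R^-1).
pose D := [set z | B z `<=` @rV_cons n @^-1` U].
have -> : @rV_cons n @^-1` U = \bigcup_(z in D) B z.
  apply/seteqP; split=> [[x u] /= Uxu|z [w Dw Bw]]; last exact: Dw.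
  have /nbhs_ballP[e /= e0 eU] : nbhs (rV_cons (x, u)) U.
    exact: open_nbhs_nbhs.
  have [k ke] : exists k : nat, k.+1%:R^-1 + k.+1%:R^-1 < e.
    have e20 : 0 < e / 2 by rewrite divr_gt0.
    have [k _ /(_ k (leqnn k)) /= kk] := near_infty_natSinv_lt (PosNum e20).
    by exists k; rewrite (splitr e) ltrD.
  have k0 : 0 < k.+1%:R^-1 :> R by rewrite invr_gt0.
  move: ke k0; set h : R := k.+1%:R^-1 => ke h0.
  have h20 : 0 < h / 2 by rewrite divr_gt0.
  have h2h : h / 2 <= h by rewrite ler_pdivrMr// ler_peMr ?ler1n ?ltW.
  have ratP (a : R) : exists q : rat, ball (ratr q : R) (h / 2) a.
    have [|q] := @rat_in_itvoo R (a - h / 2) (a + h / 2).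
      by rewrite ltrBlDr -addrA ltrDl addr_gt0.
    rewrite in_itv/= => /andP[q1 q2]; exists q.
    by rewrite /ball/= ltr_distl q1 q2.
  have [q qx] := ratP x.
  have /choice[p pu] : forall i, exists p : rat, ball (ratr p : R) (h / 2) (u 0 i).
    by move=> i; exact: ratP.
  have bu : ball (map_mx ratr (\row_i p i) : 'rV[R]_n) (h / 2) u.
    by split=> // i j; rewrite (ord1 i) !mxE; exact: pu.
  exists (q, \row_i p i, k).
    move=> [y v] /= [yq /= vp]; apply: eU; apply/ball_rV_cons => //; split.
      apply: le_ball (ltW ke) _ _; apply: ball_triangle yq.
      by apply: ball_sym; apply: le_ball qx.
    apply: le_ball (ltW ke) _ _; apply: ball_triangle vp.
    by apply: ball_sym; apply: le_ball bu.
  by split => /=; [apply: le_ball qx|apply: le_ball bu].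
rewrite bigcup_mkcond; apply: countable_bigcupT_measurable => // z.
case: ifPn => // _; rewrite /B; apply: measurableX.
  exact: measurable_realfun.measurable_ball.
by apply: open_measurable_rV; exact: ball_open.
Qed.

Local Open Scope ereal_scope.

(* Product Lebesgue measure, transported along (x, u) |-> (x, u_0, ..., u_n-1).
   It is only a set function here; the measure and sigma-finiteness instances
   are established below. *)
Fixpoint lebesgue_rV n : set 'rV[R]_n -> \bar R :=
  match n with
  | 0 => dirac (0%R : 'rV[R]_0)
  | n'.+1 => pushforward (lebesgue_measure \x @lebesgue_rV n')
      (@rV_cons n' : measurableTypeR R * 'rV[R]_n' -> 'rV[R]_n'.+1)
  end.

End lebesgue_rV.

Section ball_finite.
Local Open Scope ereal_scope.
Context {R : realType} {n : nat} (m : {measure set 'rV[R]_n -> \bar R}).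
Hypothesis mfin : forall r : R, m (ball 0%R r) < +oo.

Lemma ball_finite_sigma_finite : sigma_finite setT m.
Proof.
exists (fun k => ball (0%R : 'rV[R]_n) k%:R).
  apply/seteqP; split=> // x _ /=.
  exists (Num.truncn `|x|%R).+1 => //=.
  by rewrite mx_norm_ball /ball_ /= sub0r normrN truncnS_gt.
move=> k; split; last exact: mfin.
by apply: open_measurable_rV; exact: ball_open.
Qed.

Let bm : set 'rV[R]_n -> \bar R := m.

HB.instance Definition _ := Measure.on bm.
HB.instance Definition _ :=
  Measure_isSigmaFinite.Build _ _ _ bm ball_finite_sigma_finite.

Lemma sigma_finite_measure_exists :
  exists m' : {sigma_finite_measure set 'rV[R]_n -> \bar R},
    m = m' :> (set _ -> \bar R).
Proof. by exists bm. Qed.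

End ball_finite.

Section lebesgue_rV_measure.
Variable R : realType.
Local Open Scope ereal_scope.

Let lebesgue_rV_spec n : exists m : {measure set 'rV[R]_n -> \bar R},
  @lebesgue_rV R n = m /\ forall r : R, m (ball 0%R r) < +oo.
Proof.
elim: n => [|n [m [em mfin]]].
  exists (dirac (0%R : 'rV[R]_0)); split => // r.
  by rewrite /= /dirac /= ltry.
have [m' m'E] := sigma_finite_measure_exists mfin.
pose p : {measure set (measurableTypeR R * 'rV[R]_n) -> \bar R} := lebesgue_measure \x m'.
have [q qE] : exists q : {measure set 'rV[R]_n.+1 -> \bar R},
    pushforward p (@rV_cons R n) = q.
  by exists (measure_function_pushforward__canonical__measure_function_Measure
    p (@measurable_rV_cons R n)).
exists q; split; first by rewrite /= em m'E.
move=> r; rewrite -qE /pushforward.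
have [r0|r0] := leP r 0%R.
  rewrite [X in p X](_ : _ = set0) ?measure0//.
  rewrite -subset0 => x /= [+ _].
  by rewrite ltNge r0.
have -> : @rV_cons R n @^-1` ball 0%R r = ball 0%R r `*` ball 0%R r.
  have cons0 : rV_cons (0%R, 0%R) = 0%R :> 'rV[R]_n.+1.
    apply/rowP => j; rewrite [RHS]mxE.
    case: (unliftP (0%R : 'I_n.+1) j) => [k|] ->; first by rewrite rV_consES mxE.
    by rewrite rV_consE0.
  rewrite -cons0; apply/seteqP; split=> [[x u]|[x u]] /=.
    by move/ball_rV_cons => /(_ r0).
  by move=> H; apply/ball_rV_cons.
have -> : p (ball 0%R r `*` ball 0%R r) =
    lebesgue_measure (ball (0%R : R) r) * m' (ball 0%R r).
  apply: product_measure1E; first exact: measurable_realfun.measurable_ball.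
  by apply: open_measurable_rV; exact: ball_open.
rewrite lebesgue_measure_ball ?ltW// -m'E.
by rewrite lte_mul_pinfty// ?lee_fin ?mulrn_wge0 ?ltW.
Qed.

Let lebesgue_rV0 n : @lebesgue_rV R n set0 = 0.
Proof. by have [m [-> _]] := lebesgue_rV_spec n; rewrite measure0. Qed.

Let lebesgue_rV_ge0 n A : 0 <= @lebesgue_rV R n A.
Proof. by have [m [-> _]] := lebesgue_rV_spec n; exact: measure_ge0. Qed.

Let lebesgue_rV_sigma_additive n : semi_sigma_additive (@lebesgue_rV R n).
Proof.
have [m [-> _]] := lebesgue_rV_spec n; exact: measure_semi_sigma_additive.
Qed.

HB.instance Definition _ n := isMeasure.Build _ _ _ (@lebesgue_rV R n)
  (@lebesgue_rV0 n) (@lebesgue_rV_ge0 n) (@lebesgue_rV_sigma_additive n).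

Let lebesgue_rV_sigma_finite n : sigma_finite setT (@lebesgue_rV R n).
Proof.
apply: ball_finite_sigma_finite => r.
by have [m [mE mfin]] := lebesgue_rV_spec n; have := mfin r; rewrite -mE.
Qed.

HB.instance Definition _ n := Measure_isSigmaFinite.Build _ _ _
  (@lebesgue_rV R n) (@lebesgue_rV_sigma_finite n).

End lebesgue_rV_measure.
Arguments lebesgue_rV {R} n.

Local Notation Re := complex.Re.
Local Notation Im := complex.Im.
Local Open Scope complex_scope.

Section complex_integral.
Context {R : realType} {d : nat}.
Implicit Types f : 'rV[R]_d -> R[i].

(* R[i] has no measurable or normed R-module structure in the library, so
   integrals and derivatives of complex-valued functions are taken on the real
   and imaginary parts. *)
Definition cintegrable f : Prop :=
  (lebesgue_rV d).-integrable setT (fun x => (Re (f x))%:E) /\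
  (lebesgue_rV d).-integrable setT (fun x => (Im (f x))%:E).

Definition cintegral f : R[i] :=
  (\int[lebesgue_rV d]_x Re (f x)) +i* (\int[lebesgue_rV d]_x Im (f x)).

Definition dotmul (x y : 'rV[R]_d) : R := (x *m y^T) 0 0.

(* cis t = exp (i t) *)
Definition cis (t : R) : R[i] := cos t +i* sin t.

Definition fourier f (x : 'rV[R]_d) : R[i] :=
  ((2 * pi) `^ (- (d%:R / 2)))%:C *
  cintegral (fun y => f y * cis (- dotmul x y)).

End complex_integral.

Section complex_derivatives.
Context {R : realType} {d : nat}.
Implicit Types f g : 'rV[R]_d -> R[i].

Definition cpartial (i : 'I_d) f : 'rV[R]_d -> R[i] := fun x =>
  ('D_(delta_mx 0 i) (fun y => Re (f y)) x) +i*
  ('D_(delta_mx 0 i) (fun y => Im (f y)) x).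

(* Iterated partial derivatives are indexed by words of directions rather than
   multi-indices: the smooth functions are those all of whose iterated partial
   derivatives, in every order, exist and are continuous. *)
Definition cpartials (w : seq 'I_d) f : 'rV[R]_d -> R[i] :=
  foldr cpartial f w.

Definition csmooth f : Prop := forall w : seq 'I_d,
  [/\ continuous (fun x => Re (cpartials w f x)),
      continuous (fun x => Im (cpartials w f x)),
      forall i x, derivable (fun y => Re (cpartials w f y)) x (delta_mx 0 i) &
      forall i x, derivable (fun y => Im (cpartials w f y)) x (delta_mx 0 i)].

Definition multi_index := {ffun 'I_d -> nat}.

Definition mi_deg (a : multi_index) : nat := (\sum_i a i)%N.

(* D^a is cpartials (mi_word a). *)
Definition mi_word (a : multi_index) : seq 'I_d :=
  flatten [seq nseq (a i) i | i <- enum 'I_d].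

Definition monomial (a : multi_index) (x : 'rV[R]_d) : R :=
  \prod_i x 0 i ^+ a i.

(* cpartials w f ranges over all the D^b f: for smooth f the order of
   differentiation is immaterial. *)
Definition is_schwartz f : Prop := csmooth f /\
  forall (a : multi_index) (w : seq 'I_d), exists M : R, forall x,
    `|(monomial a x)%:C * cpartials w f x| <= M%:C.

Lemma size_mi_word (a : multi_index) : size (mi_word a) = mi_deg a.
Proof.
rewrite size_flatten /shape -map_comp sumnE big_map big_enum /=.
by apply: eq_bigr => i _; rewrite size_nseq.
Qed.

Lemma cpartials_cat v w f : cpartials v (cpartials w f) = cpartials (v ++ w) f.
Proof. by rewrite /cpartials foldr_cat. Qed.

Lemma ReD (a b : R[i]) : Re (a + b) = Re a + Re b.
Proof. by case: a; case: b. Qed.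

Lemma ImD (a b : R[i]) : Im (a + b) = Im a + Im b.
Proof. by case: a; case: b. Qed.

Lemma ReM (a b : R[i]) : Re (a * b) = Re a * Re b - Im a * Im b.
Proof. by case: a; case: b. Qed.

Lemma ImM (a b : R[i]) : Im (a * b) = Re a * Im b + Im a * Re b.
Proof. by case: a; case: b. Qed.

Lemma Re_lin (k : R[i]) f g :
  (fun y => Re ((k *: f + g) y)) =
  (Re k *: (fun y => Re (f y)) + - Im k *: (fun y => Im (f y)) +
   (fun y => Re (g y)) : 'rV[R]_d -> R).
Proof. by apply/funext => y; rewrite !fctE ReD ReM -mulNr. Qed.

Lemma Im_lin (k : R[i]) f g :
  (fun y => Im ((k *: f + g) y)) =
  (Re k *: (fun y => Im (f y)) + Im k *: (fun y => Re (f y)) +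
   (fun y => Im (g y)) : 'rV[R]_d -> R).
Proof. by apply/funext => y; rewrite !fctE ImD ImM. Qed.

Lemma is_derive_lin (a b : R) (p q r : 'rV[R]_d -> R) x v :
  derivable p x v -> derivable q x v -> derivable r x v ->
  is_derive x v (a *: p + b *: q + r : 'rV[R]_d -> R)
    (a * 'D_v p x + b * 'D_v q x + 'D_v r x).
Proof.
move=> /derivableP dp /derivableP dq /derivableP dr.
exact: is_deriveD (is_deriveD (is_deriveZ a dp) (is_deriveZ b dq)) dr.
Qed.

Lemma continuous_lin (a b : R) (p q r : 'rV[R]_d -> R) :
  continuous p -> continuous q -> continuous r ->
  continuous (a *: p + b *: q + r : 'rV[R]_d -> R).
Proof.
move=> cp cq cr x; apply: continuousD; last exact: cr.
by apply: continuousD; apply: continuousZr; [exact: cp|exact: cq].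
Qed.

Lemma cpartials_lin (k : R[i]) f g w : csmooth f -> csmooth g ->
  cpartials w (k *: f + g) = k *: cpartials w f + cpartials w g.
Proof.
move=> sf sg; elim: w => [//|i w IH] /=; rewrite IH.
have [_ _ Rf If] := sf w; have [_ _ Rg Ig] := sg w.
apply/funext => x; rewrite /cpartial Re_lin Im_lin !fctE.
have [_ ->] := is_derive_lin (Re k) (- Im k) (Rf i x) (If i x) (Rg i x).
have [_ ->] := is_derive_lin (Re k) (Im k) (If i x) (Rf i x) (Ig i x).
apply/eqP; rewrite eq_complex /= ReD ImD ReM ImM /= -mulNr.
by apply/andP.
Qed.

Lemma csmooth_lin (k : R[i]) f g :
  csmooth f -> csmooth g -> csmooth (k *: f + g).
Proof.
move=> sf sg w; rewrite cpartials_lin//.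
have [cRf cIf Rf If] := sf w; have [cRg cIg Rg Ig] := sg w.
rewrite Re_lin Im_lin; split.
- exact: continuous_lin.
- exact: continuous_lin.
- by move=> i x; have [] :=
    is_derive_lin (Re k) (- Im k) (Rf i x) (If i x) (Rg i x).
- by move=> i x; have [] :=
    is_derive_lin (Re k) (Im k) (If i x) (Rf i x) (Ig i x).
Qed.

Lemma csmooth_cpartials w f : csmooth f -> csmooth (cpartials w f).
Proof. by move=> sf v; rewrite cpartials_cat. Qed.

Lemma schwartz_cpartials w f : is_schwartz f -> is_schwartz (cpartials w f).
Proof.
move=> [sf bf]; split; first exact: csmooth_cpartials.
by move=> a v; rewrite cpartials_cat.
Qed.

Lemma cpartials0 w : cpartials w 0 = 0 :> ('rV[R]_d -> R[i]).
Proof.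
elim: w => [//|i w /= ->]; apply/funext => x.
by rewrite /cpartial !derive_cst.
Qed.

Lemma csmooth0 : csmooth 0.
Proof.
move=> w; rewrite cpartials0; split=> *; try exact: cst_continuous; exact: derivable_cst.
Qed.

Lemma schwartz_lin (k : R[i]) f g :
  is_schwartz f -> is_schwartz g -> is_schwartz (k *: f + g).
Proof.
move=> [sf bf] [sg bg]; split; first exact: csmooth_lin.
move=> a w; have [M Mf] := bf a w; have [N Ng] := bg a w.
exists (Re `|k| * M + N) => x.
rewrite cpartials_lin// !fctE mulrDr rmorphD rmorphM.
have kE : (Re `|k|)%:C = `|k| by case: (k) => u v; rewrite normc_def.
rewrite [X in X * M%:C]kE.
apply: le_trans (ler_normD _ _) _; apply: lerD (Ng x).
by rewrite mulrCA normrM ler_wpM2l.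
Qed.

Definition schwartz_pred : {pred 'rV[R]_d -> R[i]} := fun f => `[< is_schwartz f >].

Lemma schwartz_submod_closed : submod_closed schwartz_pred.
Proof.
split.
  apply/asboolP; split; first exact: csmooth0.
  by move=> a w; exists 0 => x; rewrite cpartials0 mulr0 normr0.
by move=> k f g /asboolP sf /asboolP sg; apply/asboolP; exact: schwartz_lin.
Qed.

HB.instance Definition _ :=
  GRing.isSubmodClosed.Build R[i] _ schwartz_pred schwartz_submod_closed.

End complex_derivatives.
Arguments multi_index d : clear implicits.
Arguments schwartz_pred : clear implicits.

Section schwartz_space.
Variables (R : realType) (d : nat).

Record schwartz := Schwartz {
  schwartz_fun :> 'rV[R]_d -> R[i];
  schwartz_funP : schwartz_fun \in schwartz_pred R d }.

HB.instance Definition _ := [isSub for schwartz_fun].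
HB.instance Definition _ := [Choice of schwartz by <:].
HB.instance Definition _ := [SubChoice_isSubLmodule of schwartz by <:].

End schwartz_space.

Section tempered_distributions.
Variables (R : realType) (d : nat).
Implicit Types (T : schwartz R d -> R[i]) (g h : schwartz R d).

(* The sets {g | schwartz_near N e g h} are basic neighbourhoods of h for the
   locally convex topology of the seminorms sup_x |x^a D^b g(x)|. *)
Definition schwartz_near (N : nat) (e : R) g h : Prop :=
  forall (a : multi_index d) (w : seq 'I_d) (x : 'rV[R]_d),
    (mi_deg a <= N)%N -> (size w <= N)%N ->
    `|(monomial a x)%:C * cpartials w (g - h) x| < e%:C.

Definition schwartz_continuous T : Prop :=
  forall (g : schwartz R d) (e : R), 0 < e ->
  exists (N : nat) (r : R), 0 < r /\
    forall h, schwartz_near N r h g -> `|T h - T g| < e%:C.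

Definition is_tempered T : Prop := scalar T /\ schwartz_continuous T.

Definition tempered_pred : {pred schwartz R d -> R[i]} :=
  fun T => `[< is_tempered T >].

Lemma schwartz_near_le N N' r r' g h : (N <= N')%N -> r' <= r ->
  schwartz_near N' r' g h -> schwartz_near N r g h.
Proof.
move=> NN rr H a w x aN wN.
by apply: lt_le_trans (H a w x (leq_trans aN NN) (leq_trans wN NN)) _; rewrite lecR.
Qed.

Lemma Re_normE (k : R[i]) : (Re `|k|)%:C = `|k|.
Proof. by case: k => u v; rewrite normc_def. Qed.

Lemma Re_norm_ge0 (k : R[i]) : 0 <= Re `|k|.
Proof. by rewrite -ler0c Re_normE. Qed.

Lemma abs_Re_le_norm (z : R[i]) : `|Re z|%:C <= `|z|.
Proof.
by case: z => a b; rewrite normc_def lecR /= -sqrtr_sqr ler_wsqrtr// lerDl sqr_ge0.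
Qed.

Lemma abs_Im_le_norm (z : R[i]) : `|Im z|%:C <= `|z|.
Proof.
by case: z => a b; rewrite normc_def lecR /= -sqrtr_sqr ler_wsqrtr// lerDr sqr_ge0.
Qed.

Lemma norm_le_Re_Im (z : R[i]) : `|z| <= (`|Re z| + `|Im z|)%:C.
Proof.
case: z => a b; rewrite normc_def lecR /=.
rewrite -(ler_pXn2r (n := 2))// ?nnegrE ?sqrtr_ge0 ?addr_ge0//.
rewrite sqr_sqrtr ?addr_ge0 ?sqr_ge0// sqrrD !real_normK ?num_real//.
by rewrite addrAC lerDl mulrn_wge0// mulr_ge0.
Qed.

Lemma tempered_submod_closed : submod_closed tempered_pred.
Proof.
split.
  apply/asboolP; split; first by move=> k g h; rewrite -[LHS]/(0 : R[i]) -[RHS]/(k * 0 + 0) mulr0 addr0.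
  move=> g e e0; exists 0%N, 1; split=> // h _.
  by rewrite -[X in `|X|]/(0 - 0 : R[i]) subrr normr0 ltcR.
move=> k S T /asboolP[lS cS] /asboolP[lT cT]; apply/asboolP; split.
  move=> a g h; rewrite !fctE lS lT.
  by rewrite -![_ *: _]/(_ * _); ring.
move=> g e e0.
have k1 : 0 < Re `|k| + 1 by rewrite ltr_wpDl// Re_norm_ge0.
have e1 : 0 < e / 2 / (Re `|k| + 1) by rewrite !divr_gt0.
have e2 : 0 < e / 2 by rewrite divr_gt0.
have [N [r [r0 Sr]]] := cS g _ e1.
have [N' [r' [r'0 Tr]]] := cT g _ e2.
exists (maxn N N'), (Order.min r r'); split; first by rewrite lt_min r0.
move=> h hg; rewrite !fctE.
have -> : k *: S h + T h - (k *: S g + T g) = k * (S h - S g) + (T h - T g).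
  by rewrite -![_ *: _]/(_ * _); ring.
apply: le_lt_trans (ler_normD _ _) _.
rewrite (splitr e) rmorphD; apply: ler_ltD; last first.
  by apply: Tr; apply: schwartz_near_le hg; rewrite ?leq_maxr// ge_min lexx orbT.
rewrite normrM.
have /ltW H : `|S h - S g| < (e / 2 / (Re `|k| + 1))%:C.
  by apply: Sr; apply: schwartz_near_le hg; rewrite ?leq_maxl// ge_min lexx.
apply: le_trans (ler_wpM2l _ H) _ => //.
rewrite -Re_normE -rmorphM lecR mulrCA.
apply: ler_piMr; first exact: ltW.
by rewrite ler_pdivrMr// mul1r lerDl.
Qed.

HB.instance Definition _ :=
  GRing.isSubmodClosed.Build R[i] _ tempered_pred tempered_submod_closed.

Record tempered := Tempered {
  tempered_fun :> schwartz R d -> R[i];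
  tempered_funP : tempered_fun \in tempered_pred }.

HB.instance Definition _ := [isSub for tempered_fun].
HB.instance Definition _ := [Choice of tempered by <:].
HB.instance Definition _ := [SubChoice_isSubLmodule of tempered by <:].

End tempered_distributions.
Arguments tempered_pred : clear implicits.

Section operators.
Context {R : realType} {d : nat}.
Implicit Types (T : tempered R d) (g h : schwartz R d).

Lemma schwartz_is g : is_schwartz g.
Proof. by have /asboolP := schwartz_funP g. Qed.

Lemma sderive_subproof (w : seq 'I_d) g :
  cpartials w g \in schwartz_pred R d.
Proof. by apply/asboolP/schwartz_cpartials; exact: schwartz_is. Qed.

Definition sderive (a : multi_index d) g : schwartz R d :=
  Schwartz (sderive_subproof (mi_word a) g).

Lemma sderive_lin a k g h :
  sderive a (k *: g + h) = k *: sderive a g + sderive a h.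
Proof.
by apply/val_inj => /=; rewrite cpartials_lin//; apply: (schwartz_is _).1.
Qed.

Lemma sderiveB a g h : sderive a (g - h) = sderive a g - sderive a h.
Proof. by rewrite addrC -scaleN1r sderive_lin scaleN1r addrC. Qed.

Lemma tderive_subproof (a : multi_index d) T :
  (fun g => (-1) ^+ mi_deg a * T (sderive a g)) \in tempered_pred R d.
Proof.
have /asboolP[lT cT] := tempered_funP T.
apply/asboolP; split.
  by move=> k g h; rewrite sderive_lin lT mulrDr mulrCA.
move=> g e e0; have [N [r [r0 Tr]]] := cT (sderive a g) e e0.
exists (N + mi_deg a)%N, r; split=> // h hg.
rewrite -mulrBr normrM normrX normrN1 expr1n mul1r; apply: Tr.
move=> b w x bN wN; rewrite -sderiveB /= cpartials_cat; apply: hg.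
  by rewrite (leq_trans bN)// leq_addr.
by rewrite size_cat size_mi_word leq_add2r.
Qed.

Definition tderive (a : multi_index d) T : tempered R d :=
  Tempered (tderive_subproof a T).

Lemma dirac0_subproof : (fun g => g 0) \in tempered_pred R d.
Proof.
apply/asboolP; split=> // g e e0; exists 0%N, e; split=> // h hg.
have := hg [ffun=> 0%N] [::] 0; rewrite /mi_deg /monomial.
rewrite !big1 => [|i _|i _]; rewrite ?ffunE// mul1r.
exact.
Qed.

Definition delta0 : tempered R d := Tempered dirac0_subproof.

Lemma integrable_schwartz (f : 'rV[R]_d -> R) g :
  (lebesgue_rV d).-integrable setT (EFin \o f) ->
  cintegrable (fun x => (f x)%:C * g x).
Proof.
move=> fi; have [sg bg] := schwartz_is g.
have [cR cI _ _] := sg [::].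
have [M Mg] := bg [ffun=> 0%N] [::].
have Mg' x : `|g x| <= M%:C.
  have := Mg x; rewrite /monomial big1 => [|i _]; last by rewrite ffunE.
  by rewrite mul1r.
have ReM' x : `|Re (g x)| <= M.
  rewrite -lecR; apply: le_trans (Mg' x); exact: abs_Re_le_norm.
have ImM' x : `|Im (g x)| <= M.
  rewrite -lecR; apply: le_trans (Mg' x); exact: abs_Im_le_norm.
split.
  rewrite [X in integrable _ _ X](_ : _ =
    (EFin \o f) \* (EFin \o (fun x => Re (g x))))%E; last first.
    by apply/funext => x; rewrite ReM /= mul0r subr0 EFinM.
  apply: integrableMl => //; first exact: continuous_measurable_rV.
  by exists M; split; [exact: num_real|move=> y My x _; exact: le_trans (ReM' x) (ltW My)].
rewrite [X in integrable _ _ X](_ : _ =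
  (EFin \o f) \* (EFin \o (fun x => Im (g x))))%E; last first.
  by apply/funext => x; rewrite ImM /= mul0r addr0 EFinM.
apply: integrableMl => //; first exact: continuous_measurable_rV.
by exists M; split; [exact: num_real|move=> y My x _; exact: le_trans (ImM' x) (ltW My)].
Qed.

Lemma L1_tempered_subproof (f : 'rV[R]_d -> R) :
  (lebesgue_rV d).-integrable setT (EFin \o f) ->
  (fun g => cintegral (fun x => (f x)%:C * g x)) \in tempered_pred R d.
Proof.
move=> fi.
have EI g := integrable_schwartz g fi.
apply/asboolP; split.
  have RI (p q r : 'rV[R]_d -> R) (a b : R) :
      (lebesgue_rV d).-integrable setT (EFin \o p) -> (lebesgue_rV d).-integrable setT (EFin \o q) ->
      (lebesgue_rV d).-integrable setT (EFin \o r) ->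
      \int[lebesgue_rV d]_x (a * p x + b * q x + r x) =
      a * (\int[lebesgue_rV d]_x p x) + b * (\int[lebesgue_rV d]_x q x) + \int[lebesgue_rV d]_x r x.
    move=> ip iq ir.
    have iap : (lebesgue_rV d).-integrable setT (EFin \o (fun x => a * p x)).
      exact: (integrableZl measurableT a ip).
    have ibq : (lebesgue_rV d).-integrable setT (EFin \o (fun x => b * q x)).
      exact: (integrableZl measurableT b iq).
    rewrite RintegralD//; last exact: (integrableD measurableT iap ibq).
    by rewrite RintegralD// !RintegralZl.
  move=> k g h; have [gR gI] := EI g; have [hR hI] := EI h.
  apply/eqP; rewrite eq_complex /cintegral ReD ImD ReM ImM /= -mulNr.
  rewrite -!RI//; apply/andP; split; apply/eqP; apply: eq_Rintegral => x _.
    by rewrite !ReM !ReD ?ImD !ReM !ImM /=; ring.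
  by rewrite !ImM !ReD ?ImD !ReM !ImM /=; ring.
move=> g e e0.
pose F := \int[lebesgue_rV d]_x `|f x|.
have F0 : 0 <= F by apply: Rintegral_ge0.
exists 0%N, (e / (F + F + 1)); split; first by rewrite divr_gt0// ltr_wpDl// addr_ge0.
set r := e / (F + F + 1) => h hg.
have fabs : (lebesgue_rV d).-integrable setT (EFin \o (fun x => `|f x|)).
  exact: (integrable_norm fi).
have hb x : `|h x - g x| <= r%:C.
  have := ltW (hg [ffun=> 0%N] [::] x _ _); rewrite /mi_deg /monomial.
  by rewrite !big1 => [|i _|i _]; rewrite ?ffunE// mul1r; exact.
have bound (q : R[i] -> R) : (forall z, `|q z|%:C <= `|z|) ->
    (lebesgue_rV d).-integrable setT (EFin \o (fun x => f x * q (h x - g x))) ->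
    `|\int[lebesgue_rV d]_x (f x * q (h x - g x))| <= r * F.
  move=> qle qi; apply: le_trans (le_normr_Rintegral _ _) _ => //.
  rewrite -RintegralZl//; apply: le_Rintegral => //.
  - exact: (integrable_norm qi).
  - exact: (integrableZl measurableT r fabs).
  move=> x _; rewrite normrM mulrC ler_wpM2r// -lecR.
  exact: le_trans (qle _) (hb x).
have [iR iI] := EI (h - g).
have subE : cintegral (fun x => (f x)%:C * h x) -
    cintegral (fun x => (f x)%:C * g x) =
    (\int[lebesgue_rV d]_x (f x * Re (h x - g x))) +i*
    (\int[lebesgue_rV d]_x (f x * Im (h x - g x))).
  have [hR hI] := EI h; have [gR gI] := EI g.
  apply/eqP; rewrite eq_complex /cintegral /= -!RintegralB//.
  apply/andP; split; apply/eqP; apply: eq_Rintegral => x _.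
    by rewrite !ReM ReD; case: (g x) => ? ? /=; ring.
  by rewrite !ImM ImD; case: (g x) => ? ? /=; ring.
rewrite subE; apply: le_lt_trans (norm_le_Re_Im _) _; rewrite ltcR /=.
have bR : `|\int[lebesgue_rV d]_x (f x * Re (h x - g x))| <= r * F.
  apply: bound; first exact: abs_Re_le_norm.
  apply: eq_integrable iR => // x _ /=; congr EFin.
  by rewrite ReM /= mul0r subr0.
have bI : `|\int[lebesgue_rV d]_x (f x * Im (h x - g x))| <= r * F.
  apply: bound; first exact: abs_Im_le_norm.
  apply: eq_integrable iI => // x _ /=; congr EFin.
  by rewrite ImM /= mul0r addr0.
apply: le_lt_trans (lerD bR bI) _.
rewrite -mulrDr /r mulrAC ltr_pdivrMr ?ltr_wpDl ?addr_ge0//.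
by rewrite ltr_pM2l// ltrDl.
Qed.

(* The distribution g |-> \int f(x) g(x) dx. *)
Definition L1_tempered (f : 'rV[R]_d -> R)
    (fi : (lebesgue_rV d).-integrable setT (EFin \o f)) : tempered R d :=
  Tempered (L1_tempered_subproof fi).

(* An exponent of a multi-index a with |a| <= m is at most m, so summing over
   {ffun 'I_d -> 'I_m.+1} with |a| <= m enumerates these multi-indices once. *)
Definition mi_of (m : nat) (a : {ffun 'I_d -> 'I_m.+1}) : multi_index d :=
  [ffun i => a i : nat].

Definition diffop (m : nat) (c : multi_index d -> R) T : tempered R d :=
  \sum_(a : {ffun 'I_d -> 'I_m.+1} | (mi_deg (mi_of a) <= m)%N)
    (c (mi_of a))%:C *: tderive (mi_of a) T.

(* \sum_(|a| <= m) c_a (i x)^a *)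
Definition diffop_symbol (m : nat) (c : multi_index d -> R)
    (x : 'rV[R]_d) : R[i] :=
  \sum_(a : {ffun 'I_d -> 'I_m.+1} | (mi_deg (mi_of a) <= m)%N)
    (c (mi_of a))%:C * \prod_i ('i%C * (x 0 i)%:C) ^+ (mi_of a i).

Definition is_green (L : tempered R d -> tempered R d) (T : tempered R d) :
  Prop := L T = delta0.

Definition positive_definite (Phi : 'rV[R]_d -> R) : Prop :=
  [/\ continuous Phi,
      forall x, Phi (- x) = Phi x &
      forall (N : nat) (x : 'I_N -> 'rV[R]_d) (c : 'rV[R]_N),
        injective x -> c != 0 ->
        0 < \sum_j \sum_k c 0 j * c 0 k * Phi (x j - x k)].

End operators.

(* Main.v *)
Require Import Defs.
From HB Require Import structures.
From mathcomp Require Import all_boot all_order all_algebra.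
From mathcomp Require Import all_classical all_reals all_analysis complex.
From mathcomp Require Import measurable_realfun ring lra.
Import Order.TTheory GRing.Theory Num.Theory.
Import numFieldNormedType.Exports.
Local Open Scope classical_set_scope.
Local Open Scope ring_scope.

(** Write [l] for the symbol of the operator and [G^ x] for the integral of
    [G y * exp (- i x.y)]. Testing [L G = delta_0] against the plane wave
    [y |-> exp (- i x.y)] would give [l x * G^ x = 1] at once, because the wave is
    an eigenfunction of every derivative and equals [1] at the origin. The wave is
    not a Schwartz function, but its products with [exp (- e^2 |y|^2 / 2)] are.
    Their derivatives of any order are bounded uniformly in [y] and in
    [0 < e <= 1], and converge pointwise to those of the wave as [e] tends to [0].
    As [G] is integrable, dominated convergence passes to the limit in the Green
    identity: this is [symbol_mul_green], and it holds at every single [x]. So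
    [G^ = 1 / l] pointwise, which is the second assertion.

    For the first assertion, [G^] is now integrable and positive, and
    [Fourier_inversion] writes [(2 pi)^d G z] as the integral of
    [cos (t.z) / l t]. Hence the quadratic form of [G] is, up to [(2 pi)^d], the
    integral of [|sum_j c_j exp (i t.u_j)|^2 / l t], which is nonnegative. If it
    were zero, the trigonometric sum would vanish almost everywhere, hence
    everywhere by continuity, and the characters of distinct points are linearly
    independent ([cis_independent]).

    Inversion is obtained from Gaussian means. The integral of [G^] against a wide
    Gaussian is, by Fubini and the explicit Fourier transform of the Gaussian, the
    integral of [G] against a narrow Gaussian density. The former tends to the
    integral of [G^] by dominated convergence and the latter to the value of [G]
    at the centre ([cvg_normal_rV_pdf_Rintegral]). The transform in one variable,
    [Rintegral_normal_pdf_cos], is the solution of a linear differential equation,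
    and [Rintegral_prod_cos] carries it to row vectors, coordinate by coordinate.

    Complex exponentials are handled through cosines and sines of a shifted
    phase, since integrals and derivatives are those of real functions. *)

Set Implicit Arguments.
Unset Strict Implicit.
Unset Printing Implicit Defensive.

(** * Integrals of real-valued functions *)

Section real_integrals.
Context {R : realType} {dT : measure_display} {T : measurableType dT}.
Context (mu : {measure set T -> \bar R}).

Lemma le_integrable_real (f g : T -> R) : measurable_fun setT f ->
  (forall x, `|f x| <= g x) -> mu.-integrable setT (EFin \o g) ->
  mu.-integrable setT (EFin \o f).
Proof.
move=> mf fg; apply: le_integrable => //; first exact/measurable_EFinP.
by move=> x _ /=; rewrite lee_fin (le_trans (fg x))// ler_norm.
Qed.

Lemma integrableM_bounded (M : R) (f h : T -> R) : measurable_fun setT h ->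
  (forall x, `|h x| <= M) -> mu.-integrable setT (EFin \o f) ->
  mu.-integrable setT (EFin \o (fun x => f x * h x)).
Proof.
move=> mh hM intf; rewrite [X in integrable _ _ X](_ : _ =
  ((EFin \o f) \* (EFin \o h))%E); last by apply/funext => x /=; rewrite EFinM.
apply: integrableMl => //; exists M; split; first exact: num_real.
by move=> y My x _; exact: le_trans (hM x) (ltW My).
Qed.

Lemma cvg_Rintegral_dominated (f_ : nat -> T -> R) (f g : T -> R) :
  (forall n, measurable_fun setT (f_ n)) ->
  (forall x, f_ n x @[n --> \oo] --> f x) ->
  mu.-integrable setT (EFin \o g) ->
  (forall n x, `|f_ n x| <= g x) ->
  \int[mu]_x f_ n x @[n --> \oo] --> \int[mu]_x f x.
Proof.
move=> mf_ f_f intg f_g.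
have mf : measurable_fun setT f.
  by apply: (measurable_fun_cvg (h := f_)) => // x _; exact: f_f.
have [|||||intf _ cv] := @dominated_convergence _ _ _ mu _ measurableT
  (fun n x => (f_ n x)%:E) (EFin \o f) (EFin \o g).
- by move=> n; exact/measurable_EFinP.
- exact/measurable_EFinP.
- by apply: aeW => x _; apply: cvg_EFin; [exact: nearW|exact: f_f].
- exact: intg.
- by apply: aeW => x n _; rewrite lee_fin.
by apply: fine_cvg; rewrite fineK ?integrable_fin_num.
Qed.

Lemma Rintegral_sum (I : Type) (s : seq I) (f : I -> T -> R) :
  (forall i, mu.-integrable setT (EFin \o f i)) ->
  mu.-integrable setT (EFin \o (fun t => \sum_(i <- s) f i t)) /\
  \int[mu]_t (\sum_(i <- s) f i t) = \sum_(i <- s) \int[mu]_t f i t.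
Proof.
move=> intf; elim: s => [|i s [intS intE]].
  rewrite big_nil; under eq_Rintegral do rewrite big_nil.
  under [X in EFin \o X]funext do rewrite big_nil.
  by split; [exact: integrable0|rewrite /Rintegral integral0].
rewrite big_cons -intE; under eq_Rintegral do rewrite big_cons.
under [X in EFin \o X]funext do rewrite big_cons.
by split; [exact: (integrableD measurableT (intf i) intS)|exact: RintegralD].
Qed.
End real_integrals.

(** * The characteristic function of the centred normal law *)

Section gaussian_line.
Context {R : realType}.
Notation mu := (@lebesgue_measure R).

(** By the fundamental theorem of calculus on [[- n, n]], and dominated
    convergence as [n] grows. *)
Lemma Rintegral_derivative_eq0 (F f : R -> R) :
  (forall x, is_derive x (1 : R) F (f x)) -> continuous f ->
  mu.-integrable setT (EFin \o f) ->
  F n%:R @[n --> \oo] --> (0 : R) -> F (- n%:R) @[n --> \oo] --> (0 : R) ->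
  \int[mu]_x f x = 0.
Proof.
move=> dF cf intf Fp Fm.
pose I n := `[- n.+1%:R, n.+1%:R]%classic : set R.
have FTC n : \int[mu]_(x in I n) f x = F n.+1%:R - F (- n.+1%:R).
  have cF x : F @ x --> F x.
    by apply/differentiable_continuous/derivable1_diffP; have [] := dF x.
  rewrite /Rintegral (@continuous_FTC2 _ f F)//.
  - by rewrite gtrN.
  - exact: continuous_subspaceT.
  - split; [by move=> x _; have [] := dF x|..].
      exact: cvg_at_right_filter.
    exact: cvg_at_left_filter.
  - by move=> x _; rewrite derive1E; have [_ ->] := dF x.
have H1 : \int[mu]_(x in I n) f x @[n --> \oo] --> \int[mu]_x f x.
  under eq_fun do rewrite Rintegral_mkcond.
  apply: (@cvg_Rintegral_dominated _ _ _ mu (fun n => f \_ (I n)) f (fun x => `|f x|)).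
  - move=> n; have mI : measurable (I n) by exact: measurable_itv.
    apply/(measurable_restrictT _ mI).
    by have /measurable_funTS := continuous_measurable_fun cf; exact.
  - move=> x; apply: cvg_near_cst; near=> n.
    rewrite patchE mem_set// /I /= in_itv/= -ler_norml.
    near: n; exists (Num.truncn `|x|) => // n /= nx.
    by rewrite (le_trans (ltW (truncnS_gt _)))// ler_nat ltnS.
  - exact: integrable_norm.
  - by move=> n x; rewrite patchE; case: ifP => // _; rewrite normr0.
have H2 : \int[mu]_(x in I n) f x @[n --> \oo] --> (0 : R).
  under eq_fun do rewrite FTC.
  rewrite -(subr0 (0 : R)); apply: cvgB.
    by have := Fp; rewrite -cvg_shiftS.
  by have := Fm; rewrite -cvg_shiftS.
exact: (cvg_unique _ H1 H2).
Unshelve. all: by end_near. Qed.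

Lemma normal_pdf0E (s x : R) : s != 0 ->
  normal_pdf 0 s x = normal_peak s * expR (- (2 * s ^+ 2)^-1 * x ^+ 2).
Proof.
move=> s0; rewrite normal_pdfE// /normal_fun subr0.
by congr (_ * expR _); field.
Qed.

Lemma is_derive_normal_pdf (s x : R) : s != 0 ->
  is_derive x (1 : R) (normal_pdf 0 s) (- (x / s ^+ 2 * normal_pdf 0 s x)).
Proof.
move=> s0; rewrite normal_pdf0E//.
have -> : normal_pdf 0 s =
  (fun y => normal_peak s * (expR \o (fun y => - (2 * s ^+ 2)^-1 * y ^+ 2)) y).
  by apply/funext => y; exact: normal_pdf0E.
apply: is_derive_eq; rewrite /= -![_ *: _]/(_ * _).
by field.
Qed.

(** The factor [|x|] is absorbed by doubling the standard deviation. *)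
Lemma normal_pdf_absM_le (s x : R) : s != 0 ->
  `|x| * normal_pdf 0 s x <= (s ^+ 2 + 1) * 2 * normal_pdf 0 (2 * s) x.
Proof.
move=> s0; have s20 : 2 * s != 0 by rewrite mulf_neq0.
rewrite !normal_pdf0E//.
have -> : normal_peak (2 * s) = normal_peak s / 2.
  rewrite /normal_peak.
  have -> : (2 * s) ^+ 2 * pi *+ 2 = 2 ^+ 2 * (s ^+ 2 * pi *+ 2) :> R by ring.
  by rewrite sqrtrM// sqrtr_sqr ger0_norm// invfM mulrC.
(* The exponents [1/2] and [1/8] of the two densities differ by [3/8]: the
   factor [expR (- u)] is what is left to absorb [|x|]. *)
set u := 3 / 8 / s ^+ 2 * x ^+ 2.
have u0 : 0 <= u by rewrite mulr_ge0 ?sqr_ge0// divr_ge0 ?sqr_ge0.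
have -> : - (2 * s ^+ 2)^-1 * x ^+ 2 = - u + - (2 * (2 * s) ^+ 2)^-1 * x ^+ 2.
  by rewrite /u; field.
rewrite expRD; set e := expR (_ * _); have e0 : 0 <= e by exact: expR_ge0.
have p0 : 0 <= normal_peak s by exact: normal_peak_ge0.
have -> : (s ^+ 2 + 1) * 2 * (normal_peak s / 2 * e) =
  (s ^+ 2 + 1) * (normal_peak s * e) by field.
have -> : `|x| * (normal_peak s * (expR (- u) * e)) =
  `|x| * expR (- u) * (normal_peak s * e) by ring.
apply: ler_wpM2r; first exact: mulr_ge0.
rewrite expRN ler_pdivrMr ?expR_gt0//.
have ss0 : 0 < s ^+ 2 by rewrite exprn_even_gt0.
apply: (@le_trans _ _ ((s ^+ 2 + 1) * (1 + u))); last first.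
  by rewrite ler_wpM2l ?expR_ge1Dx// addr_ge0// ltW.
have : s ^+ 2 * u = 3 / 8 * `|x| ^+ 2 by rewrite real_normK ?num_real// /u; field.
by move=> su; have := sqr_ge0 (`|x| - 1); nra.
Qed.

Lemma cvg_normal_pdf_natmul (s a : R) : s != 0 -> a ^+ 2 = 1 ->
  normal_pdf 0 s (a * n%:R) @[n --> \oo] --> (0 : R).
Proof.
move=> s0 a1; rewrite -cvg_shiftS.
pose C := (s ^+ 2 + 1) * 2 * normal_peak (2 * s).
apply: (@squeeze_cvgr _ _ _ _ (cst 0) (fun n => C * n.+1%:R^-1)).
- apply: nearW => n; rewrite normal_pdf_ge0/=.
  rewrite ler_pdivlMr// [leLHS]mulrC.
  have an : `|a * n.+1%:R| = n.+1%:R.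
    by rewrite -(sqrtr_sqr (_ * _)) exprMn a1 mul1r sqrtr_sqr ger0_norm.
  rewrite -{1}an; apply: (le_trans (normal_pdf_absM_le _ s0)).
  rewrite /C ler_wpM2l ?mulr_ge0 ?addr_ge0 ?sqr_ge0//.
  by apply: normal_pdf_ub; rewrite mulf_neq0.
- exact: cvg_cst.
- rewrite -(mulr0 C); apply: cvgMr; exact: cvg_harmonic.
Qed.

Lemma integrable_normal_pdf_bounded (M s : R) (h : R -> R) : continuous h ->
  (forall x, `|h x| <= M) ->
  mu.-integrable setT (EFin \o (fun x => normal_pdf 0 s x * h x)).
Proof.
move=> /continuous_measurable_fun mh hM.
exact: (@integrableM_bounded _ _ _ mu M (normal_pdf 0 s) h mh hM
  (integrable_normal_pdf 0 s)).
Qed.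

Lemma Rintegral_normal_pdf (m s : R) : \int[mu]_x normal_pdf m s x = 1.
Proof. by rewrite /Rintegral integral_normal_pdf. Qed.

Lemma integrable_normal_pdf_abs (s : R) : s != 0 ->
  mu.-integrable setT (EFin \o (fun x => `|x| * normal_pdf 0 s x)).
Proof.
move=> s0; apply: (@le_integrable_real _ _ _ mu _
  (fun x => (s ^+ 2 + 1) * 2 * normal_pdf 0 (2 * s) x)).
- apply: measurable_funM; last exact: measurable_normal_pdf.
  exact: continuous_measurable_fun (@norm_continuous _ _).
- move=> x; rewrite ger0_norm ?mulr_ge0 ?normal_pdf_ge0//.
  exact: normal_pdf_absM_le.
- rewrite [X in integrable _ _ X](_ : _ = (fun x =>
    ((s ^+ 2 + 1) * 2)%:E * (normal_pdf 0 (2 * s) x)%:E)%E)//.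
  exact: integrableZl (integrable_normal_pdf _ _).
Qed.

Lemma cos_affine_continuous (b t : R) : continuous (fun x : R => cos (b + x * t)).
Proof.
move=> x; apply: (continuous_comp (f := fun x : R => b + x * t)); last first.
  exact: continuous_cos.
by apply: cvgD; [exact: cvg_cst|apply: cvgMl; exact: cvg_id].
Qed.

Lemma sin_affine_continuous (b t : R) : continuous (fun x : R => sin (b + x * t)).
Proof.
move=> x; apply: (continuous_comp (f := fun x : R => b + x * t)); last first.
  exact: continuous_sin.
by apply: cvgD; [exact: cvg_cst|apply: cvgMl; exact: cvg_id].
Qed.

Lemma ler_norm_cos (x : R) : `|cos x| <= 1.
Proof. by rewrite ler_norml cos_geN1 cos_le1. Qed.

Lemma ler_norm_sin (x : R) : `|sin x| <= 1.
Proof. by rewrite ler_norml sin_geN1 sin_le1. Qed.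

Lemma integrable_normal_pdf_idM (s : R) (h : R -> R) : s != 0 ->
  continuous h -> (forall x, `|h x| <= 1) ->
  mu.-integrable setT (EFin \o (fun x => x * normal_pdf 0 s x * h x)).
Proof.
move=> s0 ch h1; apply: (@le_integrable_real _ _ _ mu _
  (fun x => `|x| * normal_pdf 0 s x)); last exact: integrable_normal_pdf_abs.
  apply: measurable_funM; last exact: continuous_measurable_fun.
  by apply: measurable_funM => //; exact: measurable_normal_pdf.
move=> x; rewrite !normrM [X in _ * X * _]ger0_norm ?normal_pdf_ge0//.
by rewrite ler_piMr// mulr_ge0// normal_pdf_ge0.
Qed.

(** Integration by parts: the derivative of the density [p] is
    [- x / s ^+ 2 * p]. *)
Lemma Rintegral_idM_normal_pdf_sin (s b t : R) : s != 0 ->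
  \int[mu]_x (x * normal_pdf 0 s x * sin (b + x * t)) =
  s ^+ 2 * t * \int[mu]_x (normal_pdf 0 s x * cos (b + x * t)).
Proof.
move=> s0.
have i1 := integrable_normal_pdf_idM s0 (@sin_affine_continuous b t)
  (fun x => ler_norm_sin _).
have i2 := @integrable_normal_pdf_bounded 1 s _ (@cos_affine_continuous b t)
  (fun x => ler_norm_cos _).
pose F x := normal_pdf 0 s x * sin (b + x * t).
pose f x := (- (s ^+ 2)^-1) * (x * normal_pdf 0 s x * sin (b + x * t)) +
  t * (normal_pdf 0 s x * cos (b + x * t)).
have i1' : mu.-integrable setT (EFin \o (fun x =>
    (- (s ^+ 2)^-1) * (x * normal_pdf 0 s x * sin (b + x * t)))).
  exact: (integrableZl measurableT (- (s ^+ 2)^-1) i1).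
have i2' : mu.-integrable setT (EFin \o (fun x =>
    t * (normal_pdf 0 s x * cos (b + x * t)))).
  exact: (integrableZl measurableT t i2).
have : \int[mu]_x f x = 0.
  apply: (@Rintegral_derivative_eq0 F).
  - move=> x; have dp := is_derive_normal_pdf x s0.
    have ds : is_derive x (1 : R) (fun x => sin (b + x * t)) (cos (b + x * t) * t).
      have -> : (fun x => sin (b + x * t)) = sin \o (fun x => b + x * t) by [].
      apply: is_derive_eq; rewrite -![_ *: _]/(_ * _) /=; ring.
    apply: (is_derive_eq (is_deriveM dp ds)).
    by rewrite /f -![_ *: _]/(_ * _) /=; field.
  - move=> x; apply: cvgD; apply: cvgMr.
      apply: cvgM; last exact: sin_affine_continuous.
      by apply: cvgM; [exact: cvg_id|exact: continuous_normal_pdf].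
    apply: cvgM; last exact: cos_affine_continuous.
    exact: continuous_normal_pdf.
  - exact: (integrableD measurableT i1' i2').
  - apply/norm_cvg0P; apply: (squeeze_cvgr _ (cvg_cst 0)
      (@cvg_normal_pdf_natmul s 1 s0 (expr1n _ _))).
    apply: nearW => n; rewrite mul1r normr_ge0 normrM/=.
    by rewrite ger0_norm ?normal_pdf_ge0// ler_piMr ?normal_pdf_ge0 ?ler_norm_sin.
  - apply/norm_cvg0P; apply: (squeeze_cvgr _ (cvg_cst 0)
      (@cvg_normal_pdf_natmul s (-1) s0 _)); last by rewrite sqrrN expr1n.
    apply: nearW => n; rewrite mulN1r normr_ge0 normrM/=.
    by rewrite ger0_norm ?normal_pdf_ge0// ler_piMr ?normal_pdf_ge0 ?ler_norm_sin.
rewrite RintegralD// !RintegralZl// => H.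
set A := \int[mu]_x _ in H *; set B := \int[mu]_x _ in H *.
have AB : (s ^+ 2)^-1 * A = t * B by lra.
have -> : A = s ^+ 2 * ((s ^+ 2)^-1 * A) by field.
by rewrite AB mulrA.
Qed.

(** The phase [b] makes the statement stable under adding further coordinates,
    and covers cosine and sine at once. Both sides solve the linear equation
    [F' t = - s ^+ 2 * t * F t] in the frequency [t]. *)
Lemma Rintegral_normal_pdf_cos (s b t : R) : s != 0 ->
  \int[mu]_x (normal_pdf 0 s x * cos (b + x * t)) =
  cos b * expR (- (s ^+ 2 * t ^+ 2 / 2)).
Proof.
move=> s0.
pose f (t x : R) := normal_pdf 0 s x * cos (b + x * t).
pose F t := \int[mu]_x f t x.
have intf u : mu.-integrable setT (EFin \o f u).
  exact: (@integrable_normal_pdf_bounded 1 s _ (@cos_affine_continuous b u)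
    (fun x => ler_norm_cos _)).
have df (u x : R) : is_derive u (1 : R) (f ^~ x)
    (- (x * normal_pdf 0 s x * sin (b + x * u))).
  have -> : f ^~ x = (fun u => normal_pdf 0 s x *: (cos \o (fun u => b + x * u)) u).
    by [].
  apply: is_derive_eq; rewrite -![_ *: _]/(_ * _) /=; ring.
have dF (u : R) : is_derive u (1 : R) F (- (s ^+ 2 * u) * F u).
  have Iu : `]u - 1, u + 1[%classic u.
    by rewrite /= in_itv/= ltrBlDr !ltrDl ltr01.
  pose G x := `|x| * normal_pdf 0 s x.
  have G0 x : 0 <= G x by rewrite mulr_ge0// normal_pdf_ge0.
  have iG : mu.-integrable setT (EFin \o G) by exact: integrable_normal_pdf_abs.
  have fG (v x : R) : `]u - 1, u + 1[%classic v -> setT x ->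
      `|partial1of2 f v x| <= G x.
    move=> _ _; rewrite partial1of2E; have [_ ->] := df v x.
    rewrite normrN !normrM [X in _ * X * _]ger0_norm ?normal_pdf_ge0//.
    by rewrite ler_piMr ?ler_norm_sin ?G0.
  have d1 (v x : R) : `]u - 1, u + 1[%classic v -> setT x -> derivable (f ^~ x) v 1.
    by move=> _ _; have [] := df v x.
  have H1 := derivable_under_integral measurableT Iu (fun v _ => intf v) d1 G0 iG fG.
  have H2 := differentiation_under_integral measurableT Iu (fun v _ => intf v) d1 G0 iG fG.
  apply: DeriveDef => //; rewrite -derive1E H2.
  under eq_Rintegral => x _.
    rewrite partial1of2E; have [_ ->] := df u x; rewrite -mulN1r; over.
  rewrite RintegralZl//; last first.
    exact: (integrable_normal_pdf_idM s0 (@sin_affine_continuous b u)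
      (fun x => ler_norm_sin _)).
  by rewrite Rintegral_idM_normal_pdf_sin// /F /f mulN1r mulNr.
have F0 : F 0 = cos b.
  rewrite /F /f; under eq_Rintegral do rewrite mulr0 addr0.
  rewrite RintegralZr//; last exact: integrable_normal_pdf.
  by rewrite Rintegral_normal_pdf mul1r.
pose E u := F u * expR (s ^+ 2 * u ^+ 2 / 2).
have dE (u : R) : is_derive u (1 : R) E 0.
  have de : is_derive u (1 : R) (fun u => expR (s ^+ 2 * u ^+ 2 / 2))
      (s ^+ 2 * u * expR (s ^+ 2 * u ^+ 2 / 2)).
    have -> : (fun u => expR (s ^+ 2 * u ^+ 2 / 2)) =
      expR \o (fun u => s ^+ 2 / 2 * u ^+ 2).
      by apply/funext => v /=; congr expR; field.
    apply: is_derive_eq; rewrite -![_ *: _]/(_ * _) /=.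
    have -> : s ^+ 2 / 2 * u ^+ 2 = s ^+ 2 * u ^+ 2 / 2 by field.
    by field.
  apply: (is_derive_eq (is_deriveM (dF u) de)).
  by rewrite -![_ *: _]/(_ * _); ring.
have := is_derive_0_is_cst t 0 dE; rewrite /E F0 expr0n mulr0 mul0r expR0 mulr1.
by move=> <-; rewrite -[RHS]mulrA -expRD subrr expR0 mulr1.
Qed.

End gaussian_line.

(** * Fubini on row vectors *)

Section product_integrals.
Context {R : realType} {d1 d2 : measure_display}.
Context {T1 : measurableType d1} {T2 : measurableType d2}.
Context (m1 : {sigma_finite_measure set T1 -> \bar R}).
Context (m2 : {sigma_finite_measure set T2 -> \bar R}).

Lemma integrable_tensor (f : T1 -> R) (g : T2 -> R) :
  m1.-integrable setT (EFin \o f) -> m2.-integrable setT (EFin \o g) ->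
  (m1 \x m2)%E.-integrable setT (EFin \o (fun z => f z.1 * g z.2)).
Proof.
move=> intf intg.
have /integrableP[/measurable_EFinP mf f_fin] := intf.
have /integrableP[/measurable_EFinP mg g_fin] := intg.
apply/integrable12ltyP.
  apply/measurable_EFinP; apply: measurable_funM.
    exact: measurableT_comp mf measurable_fst.
  exact: measurableT_comp mg measurable_snd.
have intg' : m2.-integrable setT (EFin \o (fun y => `|g y|)) by exact: integrable_norm.
have -> : (\int[m1]_x \int[m2]_y `|(EFin \o (fun z => (f z.1 * g z.2)%R)) (x, y)| =
    \int[m1]_x (`|f x|%:E * (\int[m2]_y `|g y|)%:E))%E.
  apply: eq_integral => x _ /=.
  under eq_integral do rewrite normrM EFinM.
  rewrite integralZl//; congr (_ * _)%E.
  by rewrite fineK// integrable_fin_num.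
have intf' : m1.-integrable setT (EFin \o (fun x => `|f x|)) by exact: integrable_norm.
rewrite integralZr//.
rewrite lte_mul_pinfty ?ltry//; first exact: integral_ge0.
by rewrite integrable_fin_num.
Qed.

(** Inner integrals may be infinite on a null set, where the real-valued
    integral takes the value [0] by convention. *)
Lemma Rintegral12_product (f : T1 * T2 -> R) :
  (m1 \x m2)%E.-integrable setT (EFin \o f) ->
  \int[m1]_x \int[m2]_y f (x, y) = \int[(m1 \x m2)%E]_z f z.
Proof.
move=> intf; rewrite /Rintegral -integral12_prod_meas1//.
have mF := measurable_fubini_F intf.
congr fine; apply: ae_eq_integral => //.
  apply/measurable_EFinP; apply: measurableT_comp mF.
  exact: fine_measurable.
have := ae_integrable1 intf; apply: filterS => x ix _.
by rewrite /fubini_F fineK// integrable_fin_num.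
Qed.

Lemma Rintegral21_product (f : T1 * T2 -> R) :
  (m1 \x m2)%E.-integrable setT (EFin \o f) ->
  \int[m2]_y \int[m1]_x f (x, y) = \int[(m1 \x m2)%E]_z f z.
Proof.
move=> intf; rewrite /Rintegral -integral21_prod_meas1//.
have mG := measurable_fubini_G intf.
congr fine; apply: ae_eq_integral => //.
  apply/measurable_EFinP; apply: measurableT_comp mG.
  exact: fine_measurable.
have := ae_integrable2 intf; apply: filterS => x ix _.
by rewrite /fubini_G fineK// integrable_fin_num.
Qed.
End product_integrals.

Section rV_integrals.
Context {R : realType}.
Notation mu := (@lebesgue_measure R).
Notation prod_mu n := (mu \x lebesgue_rV n)%E.

Lemma integrable_rV_cons n (f : 'rV[R]_n.+1 -> R) : measurable_fun setT f ->
  (prod_mu n).-integrable setT (EFin \o (fun z => f (rV_cons z))) ->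
  (lebesgue_rV n.+1).-integrable setT (EFin \o f).
Proof.
move=> mf intf.
have mf' : measurable_fun setT (EFin \o f) by exact/measurable_EFinP.
have /integrableP[_ f_fin] := @integrable_pushforward _ _ _ _ R _
  (@measurable_rV_cons R n) (prod_mu n) setT (EFin \o f)
  mf' intf measurableT.
by apply/integrableP; split => //; exact: le_lt_trans f_fin.
Qed.

Lemma Rintegral_rV_cons n (f : 'rV[R]_n.+1 -> R) : measurable_fun setT f ->
  (prod_mu n).-integrable setT (EFin \o (fun z => f (rV_cons z))) ->
  \int[lebesgue_rV n.+1]_y f y =
  \int[mu]_x \int[lebesgue_rV n]_u f (rV_cons (x, u)).
Proof.
move=> mf intf.
rewrite (Rintegral12_product intf) /Rintegral.
have mf' : measurable_fun setT (EFin \o f) by exact/measurable_EFinP.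
have <- := @integral_pushforward _ _ _ _ R _ (@measurable_rV_cons R n)
  (prod_mu n) setT (EFin \o f) mf' intf
  measurableT.
by rewrite (eq_measure_integral (lebesgue_rV n.+1)).
Qed.

End rV_integrals.

Section tensor_rV.
Context {R : realType}.
Notation mu := (@lebesgue_measure R).

Lemma dotmulE n (x y : 'rV[R]_n) : dotmul x y = \sum_i x 0 i * y 0 i.
Proof. by rewrite /dotmul mxE; apply: eq_bigr => i _; rewrite mxE. Qed.

Lemma dotmulC n (x y : 'rV[R]_n) : dotmul x y = dotmul y x.
Proof. by rewrite !dotmulE; apply: eq_bigr => i _; rewrite mulrC. Qed.

Lemma dotmulBr n (x y z : 'rV[R]_n) :
  dotmul x (y - z) = dotmul x y - dotmul x z.
Proof. by rewrite /dotmul linearB/= mulmxBr !mxE. Qed.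

Lemma measurable_coord n (i : 'I_n) :
  measurable_fun setT (fun y : 'rV[R]_n => y 0 i).
Proof. by apply: continuous_measurable_rV => x; exact: coord_continuous. Qed.

Lemma dotmul_continuous n (x : 'rV[R]_n) : continuous (dotmul x).
Proof.
have -> : dotmul x = \sum_i (fun y : 'rV[R]_n => x 0 i * y 0 i).
  by apply/funext => y; rewrite dotmulE fct_sumE.
elim/big_ind: _ => [|f g cf cg y|i _ y]; first exact: cst_continuous.
  exact: continuousD (cf y) (cg y).
exact: continuousM (@cst_continuous _ _ (x 0 i) y) (@coord_continuous R 1 n 0 i y).
Qed.

Lemma cos_dotmul_continuous n (b : R) (t : 'rV[R]_n) :
  continuous (fun y => cos (b + dotmul t y)).
Proof.
move=> y; apply: (continuous_comp (f := fun y => b + dotmul t y)); last first.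
  exact: continuous_cos.
exact: continuousD (@cst_continuous _ _ b y) (@dotmul_continuous _ t y).
Qed.

Lemma sin_dotmul_continuous n (b : R) (t : 'rV[R]_n) :
  continuous (fun y => sin (b + dotmul t y)).
Proof.
move=> y; apply: (continuous_comp (f := fun y => b + dotmul t y)); last first.
  exact: continuous_sin.
exact: continuousD (@cst_continuous _ _ b y) (@dotmul_continuous _ t y).
Qed.

Lemma measurable_prod_coord n (f : 'I_n -> R -> R) :
  (forall j, measurable_fun setT (f j)) ->
  measurable_fun setT (fun y : 'rV[R]_n => \prod_j f j (y 0 j)).
Proof.
move=> mf; apply: measurable_prod => j _.
exact: measurableT_comp (mf j) (measurable_coord j).
Qed.

Lemma prod_coord_cons n (f : 'I_n.+1 -> R -> R) (z : R * 'rV[R]_n) :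
  \prod_j f j (rV_cons z 0 j) =
  f 0 z.1 * \prod_j f (lift 0 j) (z.2 0 j).
Proof.
rewrite big_ord_recl rV_consE0; congr (_ * _).
by apply: eq_bigr => j _; rewrite rV_consES.
Qed.

Lemma integrable_prod_coord n (f : 'I_n -> R -> R) :
  (forall j, mu.-integrable setT (EFin \o f j)) ->
  (lebesgue_rV n).-integrable setT
    (EFin \o (fun y : 'rV[R]_n => \prod_j f j (y 0 j))).
Proof.
elim: n f => [|n IHn] f intf.
  have -> : (fun y : 'rV[R]_0 => \prod_j f j (y 0 j)) = cst 1.
    by apply/funext => y; rewrite big_ord0.
  apply/integrableP; split; first exact/measurable_EFinP.
  rewrite (eq_measure_integral (dirac (0 : 'rV[R]_0)))//.
  by rewrite integral_dirac//= normr1 diracT mul1e ltry.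
have mf j : measurable_fun setT (f j).
  by have /integrableP[/measurable_EFinP] := intf j.
apply: integrable_rV_cons; first exact: measurable_prod_coord.
have -> : (fun z : R * 'rV[R]_n => \prod_j f j (rV_cons z 0 j)) =
    (fun z => f 0 z.1 * (fun u : 'rV[R]_n => \prod_j f (lift 0 j) (u 0 j)) z.2).
  by apply/funext => z; rewrite prod_coord_cons.
exact: integrable_tensor (intf 0) (IHn _ (fun j => intf (lift 0 j))).
Qed.

(** Carrying the phase [b] through the induction replaces the complex
    exponential: integrating out one coordinate only shifts the phase of the
    remaining ones. *)
Lemma Rintegral_prod_cos n (f : 'I_n -> R -> R) (phi : 'I_n -> R)
    (t : 'rV[R]_n) (b : R) :
  (forall j, mu.-integrable setT (EFin \o f j)) ->
  (forall j a, \int[mu]_x (f j x * cos (a + x * t 0 j)) = cos a * phi j) ->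
  \int[lebesgue_rV n]_y ((\prod_j f j (y 0 j)) * cos (b + dotmul t y)) =
  cos b * \prod_j phi j.
Proof.
elim: n f phi t b => [|n IHn] f phi t b intf fphi.
  have -> : (fun y : 'rV[R]_0 => (\prod_j f j (y 0 j)) * cos (b + dotmul t y)) =
      cst (cos b).
    by apply/funext => y; rewrite dotmulE !big_ord0 addr0 mul1r.
  rewrite big_ord0 mulr1 /Rintegral.
  rewrite (eq_measure_integral (dirac (0 : 'rV[R]_0)))//.
  by rewrite integral_dirac//= indicT mul1r.
pose t' := \row_j t 0 (lift 0 j) : 'rV[R]_n.
have dotE (z : R * 'rV[R]_n) :
    dotmul t (rV_cons z) = z.1 * t 0 0 + dotmul t' z.2.
  rewrite !dotmulE big_ord_recl rV_consE0 mulrC; congr (_ + _).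
  by apply: eq_bigr => j _; rewrite rV_consES mxE.
have mcos : measurable_fun setT (fun y : 'rV[R]_n.+1 => cos (b + dotmul t y)).
  by apply: continuous_measurable_rV; exact: cos_dotmul_continuous.
have mf j : measurable_fun setT (f j).
  by have /integrableP[/measurable_EFinP] := intf j.
have intf' j : mu.-integrable setT (EFin \o f (lift 0 j)) by exact: intf.
have intT := integrable_tensor (intf 0) (integrable_prod_coord intf').
rewrite Rintegral_rV_cons; first last.
- have /= mc : measurable_fun setT (fun z : measurableTypeR R * 'rV[R]_n =>
      cos (b + dotmul t (rV_cons z))).
    exact: measurableT_comp mcos (@measurable_rV_cons R n).
  have := @integrableM_bounded _ _ _ _ 1 _ _ mc (fun z => ler_norm_cos _) intT.
  apply: eq_integrable => // z _ /=; rewrite prod_coord_cons.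
  done.
- by apply: measurable_funM => //; exact: measurable_prod_coord.
under eq_Rintegral => x _.
  under eq_Rintegral => u _.
    rewrite prod_coord_cons dotE /= addrA -mulrA.
    over.
  rewrite RintegralZl//; last first.
    apply: (@integrableM_bounded _ _ _ _ 1) => //.
    - by apply: continuous_measurable_rV; exact: cos_dotmul_continuous.
    - by move=> y; exact: ler_norm_cos.
    - exact: (integrable_prod_coord intf').
  rewrite (IHn (fun j => f (lift 0 j)) (fun j => phi (lift 0 j)))//; last first.
    by move=> j a; rewrite mxE fphi.
  rewrite mulrA.
  over.
rewrite RintegralZr//; last first.
  apply: (@integrableM_bounded _ _ _ _ 1) => //.
    exact: continuous_measurable_fun (@cos_affine_continuous R b (t 0 0)).
  by move=> y; exact: ler_norm_cos.
by rewrite fphi big_ord_recl mulrA.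
Qed.
End tensor_rV.

(** * Fourier inversion at a point of continuity *)

Section inversion.
Context {R : realType} {n : nat}.
Notation lam := (@lebesgue_rV R n).

Definition normal_rV_pdf (m : 'rV[R]_n) (s : R) (y : 'rV[R]_n) : R :=
  \prod_j normal_pdf (m 0 j) s (y 0 j).

Lemma normal_rV_pdf_ge0 m s y : 0 <= normal_rV_pdf m s y.
Proof. by apply: prodr_ge0 => j _; exact: normal_pdf_ge0. Qed.

Lemma integrable_normal_rV_pdf m s :
  lam.-integrable setT (EFin \o normal_rV_pdf m s).
Proof.
apply: (@integrable_prod_coord _ _ (fun j => normal_pdf (m 0 j) s)) => j.
exact: integrable_normal_pdf.
Qed.

Lemma measurable_normal_rV_pdf m s : measurable_fun setT (normal_rV_pdf m s).
Proof.
by have /integrableP[/measurable_EFinP] := integrable_normal_rV_pdf m s.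
Qed.

Lemma Rintegral_normal_rV_pdf m s : \int[lam]_y normal_rV_pdf m s y = 1.
Proof.
have := @Rintegral_prod_cos R n (fun j => normal_pdf (m 0 j) s) (fun=> 1) 0 0.
rewrite cos0 mul1r big1// => <-//.
- apply: eq_Rintegral => y _.
  by rewrite /dotmul mul0mx mxE addr0 cos0 mulr1.
- by move=> j; exact: integrable_normal_pdf.
- move=> j a; rewrite mulr1 mxE.
  under eq_Rintegral do rewrite mulr0 addr0.
  rewrite RintegralZr//; last exact: integrable_normal_pdf.
  by rewrite Rintegral_normal_pdf mul1r.
Qed.

Lemma normal_rV_pdf_ub m s y : s != 0 ->
  normal_rV_pdf m s y <= normal_peak s ^+ n.
Proof.
move=> s0; rewrite -[X in _ ^+ X]card_ord -prodr_const.
by apply: ler_prod => j _; rewrite normal_pdf_ge0 normal_pdf_ub.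
Qed.

Lemma normal_pdf_inv (m s y : R) : 0 < s ->
  normal_pdf m s^-1 y =
  normal_peak s^-1 * expR (- (s ^+ 2 * (m - y) ^+ 2 / 2)).
Proof.
move=> s0; rewrite normal_pdfE ?invr_neq0 ?gt_eqF// /normal_fun.
congr (_ * expR _).
rewrite -mulr_natr invfM exprVn invrK; ring.
Qed.

Lemma normal_peak_inv (s : R) : 0 < s ->
  normal_peak s^-1 = s * normal_peak 1.
Proof.
move=> s0; rewrite /normal_peak.
have -> : s^-1 ^+ 2 * pi *+ 2 = (s^-1) ^+ 2 * (1 ^+ 2 * pi *+ 2) :> R by ring.
by rewrite sqrtrM ?sqr_ge0// sqrtr_sqr ger0_norm ?invr_ge0 ?ltW// invfM invrK.
Qed.

(** Away from the centre, a narrow normal density is uniformly negligible with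
    respect to the standard one: their ratio is
    [s ^+ n * exp (- (s ^+ 2 - 1) * |m - y| ^ 2 / 2)]. *)
Lemma normal_rV_pdf_far (s delta : R) (m y : 'rV[R]_n) : 1 <= s -> 0 <= delta ->
  (exists j, delta <= `|m 0 j - y 0 j|) ->
  normal_rV_pdf m s^-1 y <=
  s ^+ n * expR (- ((s ^+ 2 - 1) * delta ^+ 2 / 2)) * normal_rV_pdf m 1 y.
Proof.
move=> s1 d0 [j dj]; have s0 : 0 < s by exact: lt_le_trans s1.
have ss : 0 <= s ^+ 2 - 1 by rewrite subr_ge0 exprn_ege1.
pose e k := expR (- ((s ^+ 2 - 1) * (m 0 k - y 0 k) ^+ 2 / 2)).
have e1 k : 0 <= e k <= 1.
  rewrite expR_ge0 -[leRHS]expR0 ler_expR oppr_le0.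
  by rewrite divr_ge0// mulr_ge0 ?sqr_ge0.
have -> : normal_rV_pdf m s^-1 y = s ^+ n * (\prod_k e k) * normal_rV_pdf m 1 y.
  rewrite -[X in _ ^+ X]card_ord -prodr_const -!big_split/=.
  apply: eq_bigr => k _.
  rewrite normal_pdf_inv// -[X in normal_pdf _ X]invr1 normal_pdf_inv// invr1.
  rewrite normal_peak_inv// /e -!mulrA; congr (_ * _).
  rewrite [RHS]mulrCA; congr (_ * _); rewrite -expRD; congr expR; by field.
apply: ler_wpM2r; first exact: normal_rV_pdf_ge0.
apply: ler_wpM2l; first by rewrite exprn_ge0// ltW.
rewrite (bigD1 j)//=; apply: (@le_trans _ _ (e j * 1)).
  apply: ler_wpM2l; first by case/andP: (e1 j).
  by apply: Num.Theory.prodr_ile1 => k _; exact: e1.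
rewrite mulr1 ler_expR lerN2 ler_pM2r// ler_wpM2l//.
by rewrite -[leRHS]real_normK ?num_real// ler_pXn2r// nnegrE.
Qed.

Lemma cvg_expr_mul_expR_far (delta : R) : 0 < delta ->
  (k.+1%:R : R) ^+ n * expR (- ((k.+1%:R ^+ 2 - 1) * delta ^+ 2 / 2))
    @[k --> \oo] --> (0 : R).
Proof.
move=> d0; pose c := delta ^+ 2 / 2.
have c0 : 0 < c by rewrite divr_gt0// exprn_gt0.
pose C := (n.+1)`!%:R / c ^+ n.+1 : R.
apply: (@squeeze_cvgr _ _ _ _ (cst 0) (fun k => C * k.+1%:R^-1)).
- near=> k; rewrite mulr_ge0 ?expR_ge0 ?exprn_ge0//=.
  set s : R := k.+1%:R.
  have s2 : 2 <= s by rewrite /s (ler_nat R 2); near: k; exists 1%N.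
  have -> : - ((s ^+ 2 - 1) * delta ^+ 2 / 2) = - ((s ^+ 2 - 1) * c).
    by rewrite /c mulrA.
  have s0 : 0 < s by lra.
  have x0 : 0 <= s * c by rewrite mulr_ge0 ?ltW.
  (* One term of the exponential series, of degree one more than the power of
     [s] to beat; [s <= s ^+ 2 - 1] holds because [2 <= s]. *)
  have : (s * c) ^+ n.+1 / (n.+1)`!%:R <= expR ((s ^+ 2 - 1) * c).
    apply: (@le_trans _ _ (expR (s * c))).
      by apply: le_trans (expR_ge1Dxn n x0); rewrite lerDr.
    by rewrite ler_expR ler_pM2r//; nra.
  move=> H; rewrite expRN ler_pdivrMr ?expR_gt0//.
  apply: (@le_trans _ _ (C * s^-1 * ((s * c) ^+ n.+1 / (n.+1)`!%:R))).
    rewrite /C (exprMn _ s) (exprS s) le_eqVlt; apply/orP; left; apply/eqP.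
    by field; rewrite !gt_eqF// ?exprn_gt0// ltr0n fact_gt0.
  by apply: ler_wpM2l => //; rewrite !mulr_ge0 ?invr_ge0 ?exprn_ge0 ?ltW.
- exact: cvg_cst.
- rewrite -(mulr0 C); apply: cvgMr; exact: cvg_harmonic.
Unshelve. all: by end_near. Qed.

(** Near [z] the continuity of [G] is used; far from [z] the narrow density is
    dominated by a vanishing multiple of the standard one. The far part needs such
    a pointwise bound, and not only small mass, because [G] may be unbounded. *)
Lemma cvg_normal_rV_pdf_Rintegral (G : 'rV[R]_n -> R) (z : 'rV[R]_n) :
  lam.-integrable setT (EFin \o G) -> {for z, continuous G} ->
  \int[lam]_y (G y * normal_rV_pdf z (k.+1%:R)^-1 y) @[k --> \oo] --> G z.
Proof.
move=> iG cG.
pose N k := normal_rV_pdf z (k.+1%:R)^-1.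
pose P := normal_peak (1 : R) ^+ n.
pose M := \int[lam]_y `|G y| * P + `|G z|.
have mG : measurable_fun setT G by have /integrableP[/measurable_EFinP] := iG.
have iN k : lam.-integrable setT (EFin \o N k) by exact: integrable_normal_rV_pdf.
have IN k : \int[lam]_y N k y = 1 by exact: Rintegral_normal_rV_pdf.
have kN0 k : (k.+1%:R : R)^-1 != 0 by rewrite invr_neq0// pnatr_eq0.
have N1ub y : normal_rV_pdf z 1 y <= P by rewrite normal_rV_pdf_ub// oner_neq0.
have iGN k : lam.-integrable setT (EFin \o (fun y => G y * N k y)).
  apply: (@integrableM_bounded _ _ _ _ (normal_peak (k.+1%:R)^-1 ^+ n)) => //.
    exact: measurable_normal_rV_pdf.
  move=> y; rewrite ger0_norm ?normal_rV_pdf_ge0//.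
  exact: normal_rV_pdf_ub.
have iGN1 : lam.-integrable setT (EFin \o (fun y => `|G y| * normal_rV_pdf z 1 y)).
  apply: (@integrableM_bounded _ _ _ _ P) => //.
  - exact: measurable_normal_rV_pdf.
  - by move=> y; rewrite ger0_norm ?normal_rV_pdf_ge0.
  - exact: integrable_norm.
have iGz k : lam.-integrable setT (EFin \o (fun y => G z * N k y)).
  exact: (integrableZl measurableT (G z) (iN k)).
apply/cvgrPdist_le => e e0.
have e20 : 0 < e / 2 by rewrite divr_gt0.
have /cvgrPdist_le/(_ _ e20)/nbhs_ballP[delta /= d0 Gd] := cG.
pose r k : R := k.+1%:R ^+ n *
  expR (- ((k.+1%:R ^+ 2 - 1) * delta ^+ 2 / 2)).
have r0 k : 0 <= r k by rewrite mulr_ge0 ?expR_ge0 ?exprn_ge0.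
have M0 : 0 <= M.
  rewrite addr_ge0// mulr_ge0 ?Rintegral_ge0//.
  by rewrite exprn_ge0 ?normal_peak_ge0.
have key k y : `|G z * N k y - G y * N k y| <=
    e / 2 * N k y + r k * (`|G y| * normal_rV_pdf z 1 y +
                           `|G z| * normal_rV_pdf z 1 y).
  rewrite -mulrBl normrM [X in _ * X]ger0_norm ?normal_rV_pdf_ge0//.
  have N10 := normal_rV_pdf_ge0 z 1 y.
  have Nk0 : 0 <= N k y := normal_rV_pdf_ge0 z _ y.
  have [yz|yz] := pselect (ball z delta y).
    apply: (@le_trans _ _ (e / 2 * N k y)); first by rewrite ler_wpM2r// Gd.
    by rewrite lerDl mulr_ge0// addr_ge0// mulr_ge0.
  have far : exists j, delta <= `|z 0 j - y 0 j|.
    apply: contrapT => nfar; apply: yz; split=> // i j; rewrite (ord1 i).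
    rewrite /ball/= ltNge; apply/negP => dj; apply: nfar; by exists j.
  have k1 : 1 <= k.+1%:R :> R by rewrite ler1n.
  have Nr : N k y <= r k * normal_rV_pdf z 1 y.
    exact: normal_rV_pdf_far k1 (ltW d0) far.
  apply: (@le_trans _ _ ((`|G y| + `|G z|) * (r k * normal_rV_pdf z 1 y))).
    apply: ler_pM => //; rewrite [leRHS]addrC; exact: ler_normB.
  rewrite -mulrDl mulrCA lerDr; apply: mulr_ge0 => //; exact: ltW.
have iN1 := integrable_normal_rV_pdf z 1.
have iGzN1 : lam.-integrable setT (EFin \o (fun y => `|G z| * normal_rV_pdf z 1 y)).
  exact: (integrableZl measurableT _ iN1).
have iS : lam.-integrable setT (EFin \o (fun y =>
    `|G y| * normal_rV_pdf z 1 y + `|G z| * normal_rV_pdf z 1 y)).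
  exact: (integrableD measurableT iGN1 iGzN1).
have iNk k : lam.-integrable setT (EFin \o (fun y => e / 2 * N k y)).
  exact: (integrableZl measurableT _ (iN k)).
have irS k : lam.-integrable setT (EFin \o (fun y =>
    r k * (`|G y| * normal_rV_pdf z 1 y + `|G z| * normal_rV_pdf z 1 y))).
  exact: (integrableZl measurableT (r k) iS).
have iB k : lam.-integrable setT (EFin \o (fun y => e / 2 * N k y +
    r k * (`|G y| * normal_rV_pdf z 1 y + `|G z| * normal_rV_pdf z 1 y))).
  exact: (integrableD measurableT (iNk k) (irS k)).
have bound k : `|G z - \int[lam]_y (G y * N k y)| <= e / 2 + r k * M.
  have -> : G z - \int[lam]_y (G y * N k y) =
      \int[lam]_y (G z * N k y - G y * N k y).
    by rewrite RintegralB// RintegralZl// IN mulr1.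
  have iD : lam.-integrable setT (EFin \o (fun y => G z * N k y - G y * N k y)).
    exact: (integrableB measurableT (iGz k) (iGN k)).
  apply: (le_trans (le_normr_Rintegral measurableT iD)).
  apply: (@le_trans _ _ (\int[lam]_y (e / 2 * N k y +
    r k * (`|G y| * normal_rV_pdf z 1 y + `|G z| * normal_rV_pdf z 1 y)))).
    by apply: le_Rintegral => //; exact: integrable_norm.
  rewrite RintegralD// [X in X + _]RintegralZl// IN mulr1 RintegralZl// RintegralD//.
  rewrite lerD2l ler_wpM2l//.
  rewrite [X in _ + X]RintegralZl// Rintegral_normal_rV_pdf mulr1 lerD2r.
  rewrite -RintegralZr//; last exact: integrable_norm.
  apply: le_Rintegral => //.
    exact: (integrableZr measurableT P (integrable_norm iG)).
  by move=> y _; rewrite ler_wpM2l.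
have rM : r k * M @[k --> \oo] --> (0 : R).
  by rewrite -(mul0r M); apply: cvgMl; exact: cvg_expr_mul_expR_far.
move/cvgrPdist_le : rM => /(_ _ e20) rM; near=> k.
apply: (le_trans (bound k)); rewrite [leRHS]splitr lerD2l.
have : `|0 - r k * M| <= e / 2 by near: k.
by rewrite sub0r normrN ger0_norm// mulr_ge0.
Unshelve. all: by end_near. Qed.

End inversion.

Section inversion_theorem.
Context {R : realType} {n : nat}.
Notation lam := (@lebesgue_rV R n).

Lemma measurable_dotmul_sub (z : 'rV[R]_n) :
  measurable_fun setT (fun w : 'rV[R]_n * 'rV[R]_n => dotmul w.1 (z - w.2)).
Proof.
have -> : (fun w : 'rV[R]_n * 'rV[R]_n => dotmul w.1 (z - w.2)) =
    (fun w => \sum_i w.1 0 i * (z 0 i - w.2 0 i)).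
  apply/funext => w; rewrite dotmulE; apply: eq_bigr => i _.
  by rewrite !mxE.
apply: measurable_sum => i; apply: measurable_funM.
  exact: measurableT_comp (measurable_coord i) measurable_fst.
apply: measurable_funB => //.
exact: measurableT_comp (measurable_coord i) measurable_snd.
Qed.

(** The product of the masses of a Gaussian and of its Fourier transform, and
    the source of the constant of the inversion formula. *)
Lemma normal_peak_mul_inv (s : R) : 0 < s ->
  (normal_peak s * normal_peak s^-1)^-1 = 2 * pi.
Proof.
move=> s0; have := @normal_peak_inv R s^-1; rewrite invrK invr_gt0 => /(_ s0) ->.
rewrite normal_peak_inv// mulrACA mulVf ?gt_eqF// mul1r.
rewrite /normal_peak -invfM invrK -expr2 sqr_sqrtr ?expr1n ?mul1r ?mulr_natl//.
by rewrite mulrn_wge0// pi_ge0.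
Qed.

Definition gauss_rV (s : R) (x : 'rV[R]_n) : R :=
  expR (- (s ^+ 2 * dotmul x x / 2)).

Lemma prod_expR_gauss_rV (s : R) (x : 'rV[R]_n) :
  \prod_j expR (- (s ^+ 2 * x 0 j ^+ 2 / 2)) = gauss_rV s x.
Proof.
rewrite -expR_sum /gauss_rV dotmulE sumrN mulr_sumr mulr_suml.
by congr (expR (- _)); apply: eq_bigr => j _; rewrite expr2.
Qed.

Lemma gauss_rV_ge0 s x : 0 <= gauss_rV s x. Proof. exact: expR_ge0. Qed.

Lemma dotmul_ge0 (x : 'rV[R]_n) : 0 <= dotmul x x.
Proof. by rewrite dotmulE sumr_ge0// => i _; rewrite -expr2 sqr_ge0. Qed.

Lemma gauss_rV_le1 s x : gauss_rV s x <= 1.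
Proof.
rewrite -[leRHS]expR0 ler_expR oppr_le0 divr_ge0// mulr_ge0 ?sqr_ge0//.
exact: dotmul_ge0.
Qed.

Lemma normal_rV_pdf_gauss (m : 'rV[R]_n) (s : R) y : 0 < s ->
  normal_rV_pdf m s^-1 y = normal_peak s^-1 ^+ n * gauss_rV s (m - y).
Proof.
move=> s0; rewrite -[X in _ ^+ X]card_ord -prodr_const -prod_expR_gauss_rV.
rewrite -big_split/=; apply: eq_bigr => j _.
by rewrite normal_pdf_inv// !mxE.
Qed.

Lemma cvg_gauss_rV (x : 'rV[R]_n) :
  gauss_rV (k.+1%:R)^-1 x @[k --> \oo] --> (1 : R).
Proof.
have h : (k.+1%:R^-1 : R) @[k --> \oo] --> (0 : R) by exact: cvg_harmonic.
have h2 : (k.+1%:R^-1 ^+ 2 : R) @[k --> \oo] --> (0 : R).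
  rewrite -[X in _ --> X](mulr0 (0 : R)); under eq_fun do rewrite expr2.
  exact: (cvgM h h).
rewrite /gauss_rV -[X in _ --> X](_ : expR (- (0 * dotmul x x / 2)) = 1); last first.
  by rewrite !mul0r oppr0 expR0.
apply: continuous_cvg; first exact: continuous_expR.
by apply: cvgN; apply: cvgMl; apply: cvgMl.
Qed.

Lemma gauss_rV_continuous s : continuous (gauss_rV s).
Proof.
have cq : continuous (fun y : 'rV[R]_n => dotmul y y).
  have -> : (fun y : 'rV[R]_n => dotmul y y) =
      \sum_i (fun y : 'rV[R]_n => y 0 i * y 0 i).
    by apply/funext => y; rewrite dotmulE fct_sumE.
  elim/big_ind: _ => [|f g cf cg y|i _ y]; first exact: cst_continuous.
    exact: continuousD (cf y) (cg y).
  exact: continuousM (@coord_continuous R 1 n 0 i y) (@coord_continuous R 1 n 0 i y).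
move=> y; have -> : gauss_rV s =
    expR \o (fun y => - (s ^+ 2 / 2) * dotmul y y).
  by apply/funext => v; rewrite /gauss_rV /=; congr expR; field.
apply: continuous_comp; last exact: continuous_expR.
exact: continuousM (@cst_continuous _ _ _ y) (cq y).
Qed.

Lemma measurable_gauss_rV s : measurable_fun setT (gauss_rV s).
Proof. by apply: continuous_measurable_rV; exact: gauss_rV_continuous. Qed.

(** Both sides are limits of the same Gaussian means. Damping [K] by a wide
    Gaussian makes Fubini applicable, and integrating first in the frequency turns
    the wide Gaussian into a narrow density centred at [z]. *)
Theorem Fourier_inversion (G : 'rV[R]_n -> R) (z : 'rV[R]_n)
    (K := fun x => \int[lam]_y (G y * cos (dotmul x (z - y)))) :
  lam.-integrable setT (EFin \o G) -> {for z, continuous G} ->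
  lam.-integrable setT (EFin \o K) ->
  \int[lam]_x K x = (2 * pi) ^+ n * G z.
Proof.
move=> iG cG iK.
have mcos := measurableT_comp (continuous_measurable_fun (@continuous_cos R))
  (measurable_dotmul_sub z).
have step k (s := k.+1%:R : R) :
    \int[lam]_x (K x * gauss_rV s^-1 x) =
    (2 * pi) ^+ n * \int[lam]_y (G y * normal_rV_pdf z s^-1 y).
  have s0 : 0 < s by [].
  pose f (w : 'rV[R]_n * 'rV[R]_n) : R :=
    normal_rV_pdf 0 s w.1 * G w.2 * cos (dotmul w.1 (z - w.2)).
  have intf : (lam \x lam)%E.-integrable setT (EFin \o f).
    apply: (@integrableM_bounded _ _ _ _ 1) => //.
      by move=> w; exact: ler_norm_cos.
    exact: integrable_tensor (integrable_normal_rV_pdf 0 s) iG.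
  have := Rintegral21_product intf; rewrite -(Rintegral12_product intf) /f /=.
  have -> : (fun x : 'rV[R]_n => \int[lam]_y (normal_rV_pdf 0 s x * G y *
      cos (dotmul x (z - y)))) = (fun x => normal_peak s ^+ n *
      (K x * gauss_rV s^-1 x)).
    apply/funext => x; under eq_Rintegral do rewrite -mulrA.
    rewrite RintegralZl//; last first.
      apply: (@integrableM_bounded _ _ _ _ 1) => //.
      - exact: (measurableT_comp mcos (measurable_pair1 x)).
      - by move=> w; exact: ler_norm_cos.
    rewrite -[in normal_rV_pdf _ s](invrK s) normal_rV_pdf_gauss ?invr_gt0//.
    rewrite invrK sub0r /gauss_rV /dotmul linearN/= mulNmx mulmxN opprK.
    by rewrite -mulrA [RHS]mulrCA mulrC mulrA mulrC.
  have -> : (fun y : 'rV[R]_n => \int[lam]_x (normal_rV_pdf 0 s x * G y *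
      cos (dotmul x (z - y)))) = (fun y => (normal_peak s^-1 ^+ n)^-1 *
      (G y * normal_rV_pdf z s^-1 y)).
    apply/funext => y; under eq_Rintegral do rewrite mulrAC.
    rewrite RintegralZr//; last first.
      apply: (@integrableM_bounded _ _ _ _ 1) => //.
      - exact: (measurableT_comp mcos (measurable_pair2 y)).
      - by move=> w; exact: ler_norm_cos.
      - exact: integrable_normal_rV_pdf.
    have := @Rintegral_prod_cos R n (fun=> normal_pdf 0 s)
      (fun j => expR (- (s ^+ 2 * (z - y) 0 j ^+ 2 / 2))) (z - y) 0.
    rewrite cos0 mul1r prod_expR_gauss_rV normal_rV_pdf_gauss//.
    have -> : (fun y0 : 'rV_n => (\prod_j normal_pdf 0 s (y0 0 j)) *
      cos (0 + dotmul (z - y) y0)) = (fun x => normal_rV_pdf 0 s x * cos (dotmul x (z - y))).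
      apply/funext => x; rewrite add0r dotmulC; congr (_ * _).
      by apply: eq_bigr => j _; rewrite mxE.
    move=> ->.
    - rewrite mulrCA mulKf ?expf_neq0 ?gt_eqF ?normal_peak_gt0 ?invr_neq0 ?gt_eqF//.
      by rewrite mulrC.
    - by move=> j; exact: integrable_normal_pdf.
    - by move=> j a; rewrite Rintegral_normal_pdf_cos// gt_eqF.
  have sV0 : s^-1 != 0 by rewrite invr_neq0// gt_eqF.
  rewrite RintegralZl//; last first.
    apply: (@integrableM_bounded _ _ _ _ (normal_peak s^-1 ^+ n)) => //.
      exact: measurable_normal_rV_pdf.
    move=> y; rewrite ger0_norm ?normal_rV_pdf_ge0//.
    exact: normal_rV_pdf_ub.
  rewrite RintegralZl//; last first.
    apply: (@integrableM_bounded _ _ _ _ 1) => //.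
      exact: measurable_gauss_rV.
    by move=> x; rewrite ger0_norm ?gauss_rV_ge0 ?gauss_rV_le1.
  move=> E; rewrite -(normal_peak_mul_inv s0) exprVn exprMn invfM -mulrA E.
  by rewrite mulKf// expf_neq0// gt_eqF// normal_peak_gt0// gt_eqF.
have lim1 : \int[lam]_x (K x * gauss_rV (k.+1%:R)^-1 x) @[k --> \oo] -->
    \int[lam]_x K x.
  apply: (@cvg_Rintegral_dominated _ _ _ lam _ _ (fun x => `|K x|)).
  - move=> k; apply: measurable_funM; last exact: measurable_gauss_rV.
    by have /integrableP[/measurable_EFinP] := iK.
  - move=> x; rewrite -[X in _ --> X]mulr1; apply: cvgMr.
    exact: cvg_gauss_rV.
  - exact: integrable_norm.
  - move=> k x; rewrite normrM ler_piMr// ger0_norm ?gauss_rV_ge0//.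
    exact: gauss_rV_le1.
have lim2 : \int[lam]_x (K x * gauss_rV (k.+1%:R)^-1 x) @[k --> \oo] -->
    (2 * pi) ^+ n * G z.
  under eq_fun do rewrite step.
  by apply: cvgMr; exact: cvg_normal_rV_pdf_Rintegral.
exact: (cvg_unique _ lim1 lim2).
Qed.
End inversion_theorem.

(** * Gaussian-damped plane waves as test functions *)

Section damped_waves.
Context {R : realType} {d : nat}.
Variable x : 'rV[R]_d.
Local Notation e_ i := (delta_mx 0 i : 'rV[R]_d).

(** Directional derivatives reduce to derivatives on the line, for which the
    chain rule needs no differentiability in several variables. *)
Lemma is_derive_line (f : 'rV[R]_d -> R) (y v : 'rV[R]_d) (df : R) :
  is_derive (0 : R) (1 : R) (fun h : R => f (h *: v + y)) df ->
  is_derive y v f df.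
Proof.
set g := fun h : R => f (h *: v + y).
have E : (fun h : R => h^-1 *: ((g \o shift (0 : R)) (h *: (1 : R)) - g 0)) =
    (fun h : R => h^-1 *: ((f \o shift y) (h *: v) - f y)).
  by apply/funext => h; rewrite /g /= addr0 scale0r add0r [h *: 1]mulr1.
move=> [dg dE]; apply: DeriveDef; first by move: dg; rewrite /derivable E.
by move: dE; rewrite /derive E.
Qed.

Lemma dotmulDr (u y z : 'rV[R]_d) : dotmul u (y + z) = dotmul u y + dotmul u z.
Proof. by rewrite /dotmul linearD/= mulmxDr !mxE. Qed.

Lemma dotmulZr (k : R) (u y : 'rV[R]_d) : dotmul u (k *: y) = k * dotmul u y.
Proof. by rewrite /dotmul linearZ/= -scalemxAr !mxE. Qed.

Lemma dotmul_delta (u : 'rV[R]_d) i : dotmul u (e_ i) = u 0 i.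
Proof.
rewrite dotmulE (bigD1 i)//= big1 ?addr0; last first.
  by move=> j ji; rewrite mxE eqxx (negbTE ji) mulr0.
by rewrite mxE !eqxx mulr1.
Qed.

Lemma is_derive_coord (c : R) (i j : 'I_d) (y : 'rV[R]_d) :
  is_derive y (e_ i) (fun y => c * y 0 j) (c * (i == j)%:R).
Proof.
apply: is_derive_line.
have -> : (fun h : R => c * (h *: e_ i + y) 0 j) =
  (fun h => c * (i == j)%:R * h + c * y 0 j).
  by apply/funext => h; rewrite !mxE eqxx/= eq_sym; ring.
by apply: is_derive_eq; rewrite -![_ *: _]/(_ * _); ring.
Qed.

Lemma is_derive_cos_dotmul i (y : 'rV[R]_d) :
  is_derive y (e_ i) (fun y => cos (dotmul x y)) (- x 0 i * sin (dotmul x y)).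
Proof.
apply: is_derive_line.
have -> : (fun h : R => cos (dotmul x (h *: e_ i + y))) =
  cos \o (fun h => x 0 i * h + dotmul x y).
  by apply/funext => h /=; rewrite dotmulDr dotmulZr dotmul_delta mulrC.
apply: is_derive_eq; rewrite -![_ *: _]/(_ * _) mulr0 add0r; ring.
Qed.

Lemma is_derive_sin_dotmul i (y : 'rV[R]_d) :
  is_derive y (e_ i) (fun y => sin (dotmul x y)) (x 0 i * cos (dotmul x y)).
Proof.
apply: is_derive_line.
have -> : (fun h : R => sin (dotmul x (h *: e_ i + y))) =
  sin \o (fun h => x 0 i * h + dotmul x y).
  by apply/funext => h /=; rewrite dotmulDr dotmulZr dotmul_delta mulrC.
apply: is_derive_eq; rewrite -![_ *: _]/(_ * _) mulr0 add0r; ring.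
Qed.

Lemma is_derive_gauss_rV (e : R) i (y : 'rV[R]_d) :
  is_derive y (e_ i) (gauss_rV e) (- (e * (e * y 0 i)) * gauss_rV e y).
Proof.
apply: is_derive_line.
have -> : (fun h : R => gauss_rV e (h *: e_ i + y)) =
  expR \o (fun h => - (e ^+ 2 / 2) * (h ^+ 2 + 2 * y 0 i * h + dotmul y y)).
  apply/funext => h /=; rewrite /gauss_rV; congr expR.
  rewrite !(dotmulDr, dotmulZr, dotmul_delta) ![dotmul (_ + _) _]dotmulC.
  rewrite !(dotmulDr, dotmulZr, dotmul_delta) !mxE !eqxx/=.
  by field.
apply: is_derive_eq; rewrite -![_ *: _]/(_ * _) /gauss_rV.
rewrite !(expr0n, mulr0, add0r, addr0)/=.
have -> : - (e ^+ 2 / 2) * dotmul y y = - (e ^+ 2 * dotmul y y / 2) by field.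
by field.
Qed.

(** The coefficients of the iterated derivatives of the damped waves below.
    The position [y] enters only through [e *: y], so that the Gaussian factor
    [gauss_rV e] bounds them uniformly in [e], and through bounded trigonometric
    functions. *)
Inductive wave_coef : (R -> 'rV[R]_d -> R) -> Prop :=
| wave_coef_cst c : wave_coef (fun _ _ => c)
| wave_coef_scale : wave_coef (fun e _ => e)
| wave_coef_coord i : wave_coef (fun e y => e * y 0 i)
| wave_coef_cos : wave_coef (fun _ y => cos (dotmul x y))
| wave_coef_sin : wave_coef (fun _ y => sin (dotmul x y))
| wave_coefD A B : wave_coef A -> wave_coef B ->
    wave_coef (fun e y => A e y + B e y)
| wave_coefM A B : wave_coef A -> wave_coef B ->
    wave_coef (fun e y => A e y * B e y).

Lemma wave_coef_derive A i : wave_coef A -> exists2 A', wave_coef A' &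
  forall e y, is_derive y (e_ i) (A e) (A' e y).
Proof.
elim=> [c| |j| | |{}A B tA [A' tA' dA] tB [B' tB' dB]
    |{}A B tA [A' tA' dA] tB [B' tB' dB]].
- by exists (fun _ _ => 0); [exact: wave_coef_cst|move=> e y; exact: is_derive_cst].
- by exists (fun _ _ => 0); [exact: wave_coef_cst|move=> e y; exact: is_derive_cst].
- exists (fun e _ => e * (i == j)%:R); last by move=> e y; exact: is_derive_coord.
  exact: wave_coefM wave_coef_scale (wave_coef_cst _).
- exists (fun _ y => - x 0 i * sin (dotmul x y)).
    exact: wave_coefM (wave_coef_cst _) wave_coef_sin.
  by move=> e y; exact: is_derive_cos_dotmul.
- exists (fun _ y => x 0 i * cos (dotmul x y)).
    exact: wave_coefM (wave_coef_cst _) wave_coef_cos.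
  by move=> e y; exact: is_derive_sin_dotmul.
- exists (fun e y => A' e y + B' e y); first exact: wave_coefD.
  by move=> e y; exact: (is_deriveD (dA e y) (dB e y)).
- exists (fun e y => A e y * B' e y + B e y * A' e y).
    by apply: wave_coefD; exact: wave_coefM.
  by move=> e y; exact: (is_deriveM (dA e y) (dB e y)).
Qed.

(** The logarithmic derivative [- e * (e * y_i)] of the Gaussian is itself such
    a coefficient, so that the class is stable under differentiation. *)
Lemma wave_coef_gauss_derive A i : wave_coef A -> exists2 A', wave_coef A' &
  forall e y, is_derive y (e_ i) (fun y => A e y * gauss_rV e y)
    (A' e y * gauss_rV e y).
Proof.
move=> tA; have [A' tA' dA] := wave_coef_derive i tA.
exists (fun e y => A' e y + A e y * ((-1) * (e * (e * y 0 i)))).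
  apply: wave_coefD => //; apply: wave_coefM => //.
  apply: wave_coefM; first exact: wave_coef_cst.
  exact: wave_coefM wave_coef_scale (wave_coef_coord i).
move=> e y; apply: (is_derive_eq (is_deriveM (dA e y) (is_derive_gauss_rV e i y))).
by rewrite -![_ *: _]/(_ * _); ring.
Qed.

Lemma wave_coef_continuous A e : wave_coef A -> continuous (A e).
Proof.
elim=> [c| |j| | |{}A B _ cA _ cB|{}A B _ cA _ cB] y.
- exact: cst_continuous.
- exact: cst_continuous.
- exact: continuousM (@cst_continuous _ _ e y) (@coord_continuous R 1 d 0 j y).
- by have := @cos_dotmul_continuous R d 0 x y; under eq_fun do rewrite add0r.
- by have := @sin_dotmul_continuous R d 0 x y; under eq_fun do rewrite add0r.
- exact: continuousD (cA y) (cB y).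
- exact: continuousM (cA y) (cB y).
Qed.

Lemma wave_coef_cvg0 A y : wave_coef A ->
  A (k.+1%:R)^-1 y @[k --> \oo] --> A 0 y.
Proof.
have h : (k.+1%:R^-1 : R) @[k --> \oo] --> (0 : R) by exact: cvg_harmonic.
elim=> [c| |j| | |{}A B _ cA _ cB|{}A B _ cA _ cB] //; try exact: cvg_cst.
- by apply: cvgMl.
- exact: cvgD cA cB.
- exact: cvgM cA cB.
Qed.

Lemma wave_coef_bound A : wave_coef A -> exists (C : R) (N : nat), 0 <= C /\
  forall e y, `|e| <= 1 -> `|A e y| <= C * (1 + e ^+ 2 * dotmul y y) ^+ N.
Proof.
have S1 e y : 1 <= 1 + e ^+ 2 * dotmul y y :> R.
  by rewrite lerDl mulr_ge0 ?sqr_ge0 ?dotmul_ge0.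
elim=> [c| |j| | |{}A B _ [C [N [C0 AC]]] _ [C' [N' [C'0 BC]]]
    |{}A B _ [C [N [C0 AC]]] _ [C' [N' [C'0 BC]]]].
- by exists `|c|, 0%N; split=> // e y _; rewrite expr0 mulr1.
- by exists 1, 0%N; split=> // e y e1; rewrite expr0 mulr1.
- exists 1, 1%N; split=> // e y _; rewrite mul1r expr1.
  have : `|e * y 0 j| ^+ 2 <= e ^+ 2 * dotmul y y.
    rewrite real_normK ?num_real// exprMn ler_wpM2l ?sqr_ge0//.
    rewrite dotmulE (bigD1 j)//= -expr2 lerDl sumr_ge0// => i _.
    by rewrite -expr2 sqr_ge0.
  by have := sqr_ge0 (`|e * y 0 j| - 1); have := normr_ge0 (e * y 0 j); nra.
- by exists 1, 0%N; split=> // e y _; rewrite expr0 mulr1 ler_norm_cos.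
- by exists 1, 0%N; split=> // e y _; rewrite expr0 mulr1 ler_norm_sin.
- exists (C + C'), (N + N')%N; split; first exact: addr_ge0.
  move=> e y e1; apply: (le_trans (ler_normD _ _)); rewrite mulrDl.
  apply: lerD.
    apply: (le_trans (AC _ _ e1)); rewrite ler_wpM2l// ler_weXn2l//.
    exact: leq_addr.
  apply: (le_trans (BC _ _ e1)); rewrite ler_wpM2l// ler_weXn2l//.
  exact: leq_addl.
- exists (C * C'), (N + N')%N; split; first exact: mulr_ge0.
  move=> e y e1; rewrite normrM exprD mulrACA.
  by apply: ler_pM => //; [exact: AC|exact: BC].
Qed.

(** With [u := S / (2 (N + 1))], [expR (S / 2)] is the [(N + 1)]-th power of
    [expR u], and [1 + S <= 2 (N + 1) (1 + u) <= 2 (N + 1) expR u]. *)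
Lemma expr1D_mul_expR_bounded (N : nat) (S : R) : 0 <= S ->
  (1 + S) ^+ N * expR (- (S / 2)) <= (2 * N.+1%:R) ^+ N.+1.
Proof.
move=> S0; rewrite expRN ler_pdivrMr ?expR_gt0//.
have N0 : 0 < N.+1%:R :> R by [].
have N1 : 1 <= N.+1%:R :> R by rewrite ler1n.
have S1 : 1 <= 1 + S by rewrite lerDl.
apply: (@le_trans _ _ ((1 + S) ^+ N.+1)); first by rewrite ler_weXn2l.
pose u := S / 2 / N.+1%:R.
have u0 : 0 <= u by rewrite !divr_ge0.
have SE : S = 2 * N.+1%:R * u by rewrite /u; field.
have -> : expR (S / 2) = expR u ^+ N.+1.
  by rewrite -expRM_natl /u; congr expR; field.
rewrite -exprMn ler_pXn2r ?nnegrE ?mulr_ge0 ?expR_ge0//; last lra.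
apply: (@le_trans _ _ (2 * N.+1%:R * (1 + u))); first by rewrite SE; nra.
by rewrite ler_wpM2l ?expR_ge1Dx// mulr_ge0.
Qed.

Lemma wave_coef_gauss_bound A : wave_coef A -> exists2 M : R, 0 <= M &
  forall e y, `|e| <= 1 -> `|A e y * gauss_rV e y| <= M.
Proof.
move=> /wave_coef_bound[C [N [C0 AC]]].
exists (C * (2 * N.+1%:R) ^+ N.+1); first by rewrite mulr_ge0 ?exprn_ge0 ?mulr_ge0.
move=> e y e1; rewrite normrM [X in _ * X]ger0_norm ?gauss_rV_ge0//.
apply: (@le_trans _ _ (C * (1 + e ^+ 2 * dotmul y y) ^+ N * gauss_rV e y)).
  by rewrite ler_wpM2r ?gauss_rV_ge0 ?AC.
rewrite -mulrA ler_wpM2l// expr1D_mul_expR_bounded//.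
by rewrite mulr_ge0 ?sqr_ge0 ?dotmul_ge0.
Qed.
End damped_waves.

Section damped_wave.
Context {R : realType} {d : nat}.
Variable x : 'rV[R]_d.
Local Open Scope complex_scope.

(** For [e = 0] this is the plane wave itself, which is not a Schwartz function
    but obeys the same formulas for its derivatives. *)
Definition damped_wave (e : R) (y : 'rV[R]_d) : R[i] :=
  (gauss_rV e y)%:C * cis (- dotmul x y).

Lemma cpartials_damped_wave w : exists A B, [/\ wave_coef x A, wave_coef x B &
  forall e, cpartials w (damped_wave e) =
    fun y => (A e y * gauss_rV e y) +i* (B e y * gauss_rV e y)].
Proof.
elim: w => [|i w [A [B [tA tB E]]]].
  exists (fun _ y => cos (dotmul x y)), (fun _ y => (-1) * sin (dotmul x y)).
  split; [exact: wave_coef_cos| |].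
    exact: wave_coefM (wave_coef_cst _ _) (wave_coef_sin _).
  move=> e; apply/funext => y; rewrite /= /damped_wave /cis cosN sinN.
  by apply/eqP; rewrite eq_complex /=; apply/andP; split; apply/eqP; ring.
have [A' tA' dA] := wave_coef_gauss_derive i tA.
have [B' tB' dB] := wave_coef_gauss_derive i tB.
exists A', B'; split=> // e; apply/funext => y /=; rewrite E /cpartial /=.
by have [_ ->] := dA e y; have [_ ->] := dB e y.
Qed.

Lemma monomial_wave_coef (a : multi_index d) :
  wave_coef x (fun e y => monomial a (e *: y)).
Proof.
have tX i k : wave_coef x (fun e y => (e * y 0 i) ^+ k).
  elim: k => [|k IHk]; first exact: wave_coef_cst.
  have -> : (fun (e : R) (y : 'rV[R]_d) => (e * y 0 i) ^+ k.+1) =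
      fun e y => e * y 0 i * (e * y 0 i) ^+ k.
    by apply/funext => e; apply/funext => y; rewrite exprS.
  exact: wave_coefM (wave_coef_coord _ _) IHk.
have -> : (fun e y => monomial a (e *: y)) =
    fun (e : R) (y : 'rV[R]_d) => \prod_i (e * y 0 i) ^+ a i.
  apply/funext => e; apply/funext => y; apply: eq_bigr => i _.
  by rewrite mxE.
elim: index_enum => [|i s IHs].
  have -> : (fun (e : R) (y : 'rV[R]_d) => \prod_(i <- [::]) (e * y 0 i) ^+ a i) =
      fun _ _ => 1.
    by apply/funext => e; apply/funext => y; rewrite big_nil.
  exact: wave_coef_cst.
have -> : (fun (e : R) (y : 'rV[R]_d) => \prod_(i <- i :: s) (e * y 0 i) ^+ a i) =
    fun e y => (e * y 0 i) ^+ a i * \prod_(i <- s) (e * y 0 i) ^+ a i.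
  by apply/funext => e; apply/funext => y; rewrite big_cons.
exact: wave_coefM.
Qed.

Lemma monomialZ (a : multi_index d) (e : R) (y : 'rV[R]_d) :
  monomial a (e *: y) = e ^+ mi_deg a * monomial a y.
Proof.
rewrite /monomial /mi_deg -prodrXr -big_split/=; apply: eq_bigr => i _.
by rewrite mxE exprMn.
Qed.

(** Up to the factor [e ^+ |a|], a monomial in [y] is one in [e *: y], hence one
    more coefficient in front of the Gaussian. *)
Lemma damped_wave_schwartz e : 0 < e -> e <= 1 -> is_schwartz (damped_wave e).
Proof.
move=> e0 e1; have ne1 : `|e| <= 1 by rewrite ger0_norm// ltW.
split=> [w|a w]; have [A [B [tA tB E]]] := cpartials_damped_wave w; rewrite E /=.
  have cg := @gauss_rV_continuous R d e.
  have cF F : wave_coef x F -> continuous (fun y => F e y * gauss_rV e y).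
    by move=> tF y; exact: continuousM (@wave_coef_continuous R d x F e tF y) (cg y).
  split; [exact: cF|exact: cF| |].
  - by move=> i y; have [A' _ dA] := wave_coef_gauss_derive i tA; have [] := dA e y.
  - by move=> i y; have [A' _ dA] := wave_coef_gauss_derive i tB; have [] := dA e y.
have tm := monomial_wave_coef a.
have [M _ MA] := wave_coef_gauss_bound (wave_coefM tm tA).
have [M' _ MB] := wave_coef_gauss_bound (wave_coefM tm tB).
have ea : 0 < e ^+ mi_deg a by rewrite exprn_gt0.
exists ((M + M') / e ^+ mi_deg a) => y.
apply: (le_trans (norm_le_Re_Im _)); rewrite lecR Defs.ReM Defs.ImM /=.
rewrite !mul0r subr0 addr0 ler_pdivlMr// mulrDl.
have h (r : R) (F : R) : `|monomial a y * (r * F)| * e ^+ mi_deg a =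
    `|monomial a (e *: y) * r * F|.
  by rewrite monomialZ -{1}(ger0_norm (ltW ea)) -normrM; congr `|_|; ring.
by rewrite !h lerD// ?MA ?MB.
Qed.

Lemma cpartial_plane_wave i (k : R[i]) :
  cpartial i (fun y => k * cis (- dotmul x y)) =
  fun y => (- ('i * (x 0 i)%:C) * k) * cis (- dotmul x y).
Proof.
case: k => u v; apply/funext => y; rewrite /cpartial /cis /=.
have ReE : (fun y => u * cos (- dotmul x y) - v * sin (- dotmul x y)) =
    (fun y => u * cos (dotmul x y) + v * sin (dotmul x y)).
  by apply/funext => z; rewrite cosN sinN; ring.
have ImE : (fun y => u * sin (- dotmul x y) + v * cos (- dotmul x y)) =
    (fun y => (- u) * sin (dotmul x y) + v * cos (dotmul x y)).
  by apply/funext => z; rewrite cosN sinN; ring.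
have dc := is_derive_cos_dotmul x i y; have ds := is_derive_sin_dotmul x i y.
have [_ RE] := is_deriveD (is_deriveZ u dc) (is_deriveZ v ds).
have [_ IE] := is_deriveD (is_deriveZ (- u) ds) (is_deriveZ v dc).
rewrite ReE ImE RE IE cosN sinN.
by apply/eqP; rewrite eq_complex /= -![_ *: _]/(_ * _); apply/andP; split;
  apply/eqP; ring.
Qed.

Lemma cpartials_plane_wave w :
  cpartials w (fun y => cis (- dotmul x y)) =
  fun y => (\prod_(i <- w) (- ('i * (x 0 i)%:C))) * cis (- dotmul x y).
Proof.
elim: w => [|i w IHw]; first by apply/funext => y; rewrite big_nil mul1r.
by rewrite /= IHw cpartial_plane_wave big_cons.
Qed.

Lemma prod_mi_word (a : multi_index d) (f : 'I_d -> R[i]) :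
  \prod_(i <- mi_word a) f i = \prod_i f i ^+ a i.
Proof.
rewrite /mi_word big_flatten /= big_map big_enum /=.
apply: eq_bigr => i _; elim: (a i) => [|k IHk]; first by rewrite big_nil.
by rewrite /= big_cons IHk exprS.
Qed.

Lemma damped_wave0 : damped_wave 0 = fun y => cis (- dotmul x y).
Proof.
apply/funext => y; rewrite /damped_wave /gauss_rV expr0n !mul0r oppr0 expR0.
exact: mul1r.
Qed.

End damped_wave.

(** * The Fourier transform of an integrable Green function *)

Section green_transform.
Context {R : realType} {d : nat}.
Notation lam := (@lebesgue_rV R d).
Local Open Scope complex_scope.
Local Notation Re := complex.Re.
Local Notation Im := complex.Im.

Lemma cvg_sum (I : finType) (P : pred I) (u : I -> nat -> R) (l : I -> R) :
  (forall i, u i k @[k --> \oo] --> l i) ->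
  \sum_(i | P i) u i k @[k --> \oo] --> \sum_(i | P i) l i.
Proof.
move=> ul; have -> : (fun k => \sum_(i | P i) u i k) = \sum_(i | P i) u i.
  by apply/funext => k; rewrite fct_sumE.
elim/big_ind2: _ => [|f a g b fa gb|i _]; [exact: cvg_cst|exact: cvgD|exact: ul].
Qed.

Lemma cintegralZ (z : R[i]) (f : 'rV[R]_d -> R[i]) : cintegrable f ->
  cintegral (fun y => z * f y) = z * cintegral f.
Proof.
move=> [iR iI]; case: z => a b; rewrite /cintegral.
have iZ c (h : 'rV[R]_d -> R) : lam.-integrable setT (EFin \o h) ->
    lam.-integrable setT (EFin \o (fun y => c * h y)).
  exact: integrableZl.
apply/eqP; rewrite eq_complex /=; apply/andP; split; apply/eqP.
  under eq_Rintegral do rewrite Defs.ReM /=.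
  by rewrite RintegralB ?RintegralZl//; exact: iZ.
under eq_Rintegral do rewrite Defs.ImM /=.
by rewrite RintegralD ?RintegralZl//; exact: iZ.
Qed.

Lemma cintegral_realM (G : 'rV[R]_d -> R) (f : 'rV[R]_d -> R[i]) :
  cintegral (fun y => (G y)%:C * f y) =
  (\int[lam]_y (G y * Re (f y))) +i* (\int[lam]_y (G y * Im (f y))).
Proof.
by congr (_ +i* _); apply: eq_Rintegral => y _;
  rewrite (Defs.ReM, Defs.ImM) /= mul0r ?subr0 ?addr0.
Qed.

Lemma tempered_sum_apply (I : finType) (P : pred I) (T : I -> tempered R d)
    (g : schwartz R d) :
  (\sum_(i | P i) T i) g = \sum_(i | P i) T i g.
Proof.
have -> : tempered_fun (\sum_(i | P i) T i) = \sum_(i | P i) tempered_fun (T i).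
  exact: (raddf_sum (\val : tempered R d -> _)).
by rewrite fct_sumE.
Qed.

Lemma diffop_L1_apply m (c : multi_index d -> R) (G : 'rV[R]_d -> R)
    (iG : lam.-integrable setT (EFin \o G)) (g : schwartz R d) :
  diffop m c (L1_tempered iG) g =
  \sum_(a : {ffun 'I_d -> 'I_m.+1} | (mi_deg (mi_of a) <= m)%N)
    (c (mi_of a))%:C * ((-1) ^+ mi_deg (mi_of a) *
      cintegral (fun y => (G y)%:C * cpartials (mi_word (mi_of a)) g y)).
Proof. by rewrite /diffop tempered_sum_apply. Qed.

(** The bound uniform in the damping parameter is what makes [|G|] times a
    constant a dominating function. *)
Lemma cvg_Rintegral_wave_coef (x : 'rV[R]_d) (G : 'rV[R]_d -> R) A :
  lam.-integrable setT (EFin \o G) -> wave_coef x A ->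
  \int[lam]_y (G y * (A (k.+1%:R)^-1 y * gauss_rV (k.+1%:R)^-1 y))
    @[k --> \oo] --> \int[lam]_y (G y * (A 0 y * gauss_rV 0 y)).
Proof.
move=> iG tA; have [M M0 AM] := wave_coef_gauss_bound tA.
have mG : measurable_fun setT G by have /integrableP[/measurable_EFinP] := iG.
apply: (@cvg_Rintegral_dominated _ _ _ lam _ _ (fun y => `|G y| * M)).
- move=> k; apply: measurable_funM => //; apply: measurable_funM.
    apply: continuous_measurable_rV; exact: (@wave_coef_continuous R d x A _ tA).
  exact: measurable_gauss_rV.
- move=> y; apply: cvgMr; apply: cvgM; first exact: (@wave_coef_cvg0 R d x A y tA).
  have -> : gauss_rV 0 y = 1 by rewrite /gauss_rV expr0n !mul0r oppr0 expR0.
  exact: cvg_gauss_rV.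
- exact: (integrableZr measurableT M (integrable_norm iG)).
- move=> k y; rewrite normrM ler_wpM2l// AM// ger0_norm ?invr_ge0//.
  by rewrite invf_le1// ler1n.
Qed.

Definition plane_wave_integral (G : 'rV[R]_d -> R) (x : 'rV[R]_d) : R[i] :=
  cintegral (fun y => (G y)%:C * cis (- dotmul x y)).

Lemma integrable_mul_cos (G : 'rV[R]_d -> R) (x : 'rV[R]_d) :
  lam.-integrable setT (EFin \o G) ->
  lam.-integrable setT (EFin \o (fun y => G y * cos (dotmul x y))).
Proof.
apply: (@integrableM_bounded _ _ _ _ 1); last by move=> y; exact: ler_norm_cos.
apply: continuous_measurable_rV.
by have := @cos_dotmul_continuous R d 0 x; under eq_fun do rewrite add0r.
Qed.

Lemma integrable_mul_sin (G : 'rV[R]_d -> R) (x : 'rV[R]_d) :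
  lam.-integrable setT (EFin \o G) ->
  lam.-integrable setT (EFin \o (fun y => G y * sin (dotmul x y))).
Proof.
apply: (@integrableM_bounded _ _ _ _ 1); last by move=> y; exact: ler_norm_sin.
apply: continuous_measurable_rV.
by have := @sin_dotmul_continuous R d 0 x; under eq_fun do rewrite add0r.
Qed.

Lemma cintegrable_plane_wave (G : 'rV[R]_d -> R) (x : 'rV[R]_d) :
  lam.-integrable setT (EFin \o G) ->
  cintegrable (fun y => (G y)%:C * cis (- dotmul x y)).
Proof.
move=> iG; split.
  apply: eq_integrable (integrable_mul_cos x iG) => // y _ /=.
  by rewrite cosN mul0r subr0.
apply: eq_integrable (integrableN (integrable_mul_sin x iG)) => // y _ /=.
by rewrite sinN mul0r addr0 mulrN EFinN.
Qed.

Lemma plane_wave_integralE (G : 'rV[R]_d -> R) (x : 'rV[R]_d) :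
  lam.-integrable setT (EFin \o G) ->
  plane_wave_integral G x = (\int[lam]_y (G y * cos (dotmul x y))) +i*
                            (- \int[lam]_y (G y * sin (dotmul x y))).
Proof.
move=> iG; rewrite /plane_wave_integral cintegral_realM; congr (_ +i* _).
  by apply: eq_Rintegral => y _; rewrite /= cosN.
under eq_Rintegral do rewrite /= sinN -mulN1r mulrCA.
by rewrite RintegralZl ?mulN1r//; exact: integrable_mul_sin.
Qed.

(** The Green identity for the damped waves, whose value at the origin is [1],
    passes to the limit [e = 0], where each derivative multiplies the wave by a
    monomial in [- i x]; the sign of the distributional derivative turns it into
    the corresponding monomial in [i x]. *)
Lemma symbol_mul_green m (c : multi_index d -> R) (G : 'rV[R]_d -> R)
    (iG : lam.-integrable setT (EFin \o G)) (x : 'rV[R]_d) :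
  is_green (diffop m c) (L1_tempered iG) ->
  diffop_symbol m c x * plane_wave_integral G x = 1.
Proof.
move=> green.
pose T (f : 'rV[R]_d -> R[i]) : R[i] :=
  \sum_(a : {ffun 'I_d -> 'I_m.+1} | (mi_deg (mi_of a) <= m)%N)
    (c (mi_of a))%:C * ((-1) ^+ mi_deg (mi_of a) *
      cintegral (fun y => (G y)%:C * cpartials (mi_word (mi_of a)) f y)).
have Tk k : T (damped_wave x (k.+1%:R)^-1) = 1.
  have sk : damped_wave x (k.+1%:R)^-1 \in schwartz_pred R d.
    apply/asboolP; apply: damped_wave_schwartz; rewrite ?invr_gt0//.
    by rewrite invf_le1// ler1n.
  have := congr1 (fun S : tempered R d => S (Schwartz sk)) green.
  rewrite diffop_L1_apply => /(@etrans _ (T _) _ _ (erefl _)) ->.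
  rewrite /= /damped_wave /gauss_rV /dotmul !trmx0 !mulmx0 !mxE.
  by rewrite mulr0 mul0r oppr0 expR0 mul1r /cis cos0 sin0.
have signE k : ((-1) ^+ k : R[i]) = ((-1) ^+ k)%:C by rewrite rmorphXn rmorphN1.
have TE f : T f =
  (\sum_(a : {ffun 'I_d -> 'I_m.+1} | (mi_deg (mi_of a) <= m)%N)
    c (mi_of a) * ((-1) ^+ mi_deg (mi_of a) *
      \int[lam]_y (G y * Re (cpartials (mi_word (mi_of a)) f y)))) +i*
  (\sum_(a : {ffun 'I_d -> 'I_m.+1} | (mi_deg (mi_of a) <= m)%N)
    c (mi_of a) * ((-1) ^+ mi_deg (mi_of a) *
      \int[lam]_y (G y * Im (cpartials (mi_word (mi_of a)) f y)))).
  apply/eqP; rewrite eq_complex /T /= !raddf_sum /=; apply/andP; split; apply/eqP.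
    apply: eq_bigr => a _; rewrite cintegral_realM signE.
    by rewrite !(Defs.ReM, Defs.ImM) /=; ring.
  apply: eq_bigr => a _; rewrite cintegral_realM signE.
  by rewrite !(Defs.ReM, Defs.ImM) /=; ring.
have T0 : T (damped_wave x 0) = 1.
  apply/eqP; rewrite eq_complex; apply/andP; split; apply/eqP.
    have : Re (T (damped_wave x (k.+1%:R)^-1)) @[k --> \oo] --> Re (T (damped_wave x 0)).
      under eq_fun do rewrite TE /=; rewrite TE /=.
      apply: cvg_sum => a; apply: cvgMr; apply: cvgMr.
      have [A [B [tA tB E]]] := cpartials_damped_wave x (mi_word (mi_of a)).
      rewrite E; under eq_fun do rewrite E.
      exact: (cvg_Rintegral_wave_coef iG tA).
    under eq_fun do rewrite Tk.
    by move=> H; apply/esym; apply: (cvg_unique _ (cvg_cst _) H).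
  have : Im (T (damped_wave x (k.+1%:R)^-1)) @[k --> \oo] --> Im (T (damped_wave x 0)).
    under eq_fun do rewrite TE /=; rewrite TE /=.
    apply: cvg_sum => a; apply: cvgMr; apply: cvgMr.
    have [A [B [tA tB E]]] := cpartials_damped_wave x (mi_word (mi_of a)).
    rewrite E; under eq_fun do rewrite E.
    exact: (cvg_Rintegral_wave_coef iG tB).
  under eq_fun do rewrite Tk.
  by move=> H; apply/esym; apply: (cvg_unique _ (cvg_cst _) H).
rewrite -T0 /T /diffop_symbol mulr_suml; apply: eq_bigr => a _.
rewrite -mulrA; congr (_ * _).
rewrite damped_wave0 cpartials_plane_wave prod_mi_word.
under [in RHS](@eq_fun 'rV[R]_d) do rewrite mulrCA.
rewrite cintegralZ; last first.
  exact: cintegrable_plane_wave.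
rewrite mulrA; congr (_ * _); rewrite /mi_deg -prodrXr -big_split/=.
by apply: eq_bigr => i _; rewrite -exprMn mulN1r opprK.
Qed.
End green_transform.

(** * Strict positive definiteness *)

Section positivity.
Context {R : realType} {d : nat}.
Notation lam := (@lebesgue_rV R d).
Local Open Scope complex_scope.

Lemma cisD (a b : R) : cis (a + b) = cis a * cis b.
Proof.
by apply/eqP; rewrite eq_complex /= cosD sinD; apply/andP; split; apply/eqP; ring.
Qed.

Lemma cis_separates (u v : 'rV[R]_d) :
  u != v -> exists t, cis (dotmul t u) != cis (dotmul t v).
Proof.
move=> uv; have [i uvi] : exists i, u 0 i != v 0 i.
  apply: contrapT => H; move/negP: uv; apply; apply/eqP/rowP => i.
  by apply: contrapT => uvi; apply: H; exists i; exact/eqP.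
(* Along this vector the two phases differ by [pi]. *)
exists ((pi / (u 0 i - v 0 i)) *: delta_mx 0 i).
have E (w : 'rV[R]_d) : dotmul ((pi / (u 0 i - v 0 i)) *: delta_mx 0 i) w =
    pi / (u 0 i - v 0 i) * w 0 i.
  by rewrite dotmulC dotmulZr dotmul_delta.
rewrite !E; set r := pi / _.
have -> : r * u 0 i = r * v 0 i + pi.
  by rewrite /r; field; rewrite subr_eq0.
rewrite cisD; apply/eqP => H.
have := congr1 (@complex.Re R) H; have := congr1 (@complex.Im R) H.
rewrite /cis /= cospi sinpi !mulr0 !mulrN1 subr0 add0r.
move=> si ci; have := cos2Dsin2 (r * v 0 i).
have -> : cos (r * v 0 i) = 0 by lra.
have -> : sin (r * v 0 i) = 0 by lra.
by rewrite expr0n addr0 => /eqP; rewrite eq_sym oner_eq0.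
Qed.

(** Dedekind's argument: translating the variable and subtracting kills one
    character and keeps the relation among the others. *)
Lemma cis_independent (I : eqType) (u : I -> 'rV[R]_d) (s : seq I) (c : I -> R[i]) :
  injective u -> uniq s ->
  (forall t, \sum_(j <- s) c j * cis (dotmul t (u j)) = 0) ->
  forall j, j \in s -> c j = 0.
Proof.
move=> injx; elim: s c => [//|j0 s IHs] c /= /andP[j0s us] sum0.
have cs j : j \in s -> c j = 0.
  move=> js; have ujj0 : u j != u j0 by apply: contra j0s => /eqP /injx <-.
  have [h ch] := cis_separates ujj0.
  have /IHs : forall t, \sum_(k <- s) (c k *
      (cis (dotmul h (u k)) - cis (dotmul h (u j0)))) * cis (dotmul t (u k)) = 0.
    move=> t; have := sum0 t; have := sum0 (t + h).
    rewrite !big_cons => H1 H2.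
    have dE k : dotmul (t + h) (u k) = dotmul t (u k) + dotmul h (u k).
      by rewrite dotmulC dotmulDr ![dotmul (u k) _]dotmulC.
    transitivity (\sum_(k <- s) c k * cis (dotmul (t + h) (u k)) -
      cis (dotmul h (u j0)) * \sum_(k <- s) c k * cis (dotmul t (u k))).
      rewrite mulr_sumr -sumrB; apply: eq_bigr => k _.
      by rewrite dE cisD; ring.
    move: H1 H2; rewrite dE cisD.
    move=> /eqP; rewrite addrC addr_eq0 => /eqP -> /eqP.
    rewrite addrC addr_eq0 => /eqP ->; ring.
  move=> /(_ us j js) /eqP; rewrite mulf_eq0 subr_eq0 (negbTE ch) orbF.
  by move/eqP.
move=> j; rewrite inE => /predU1P[->|/cs//].
have := sum0 0; rewrite big_cons big1_seq ?addr0; last first.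
  by move=> k /andP[_ ks]; rewrite cs// mul0r.
have -> : dotmul 0 (u j0) = 0 by rewrite /dotmul mul0mx mxE.
by rewrite /cis cos0 sin0 mulr1.
Qed.

Lemma integrable_gauss_rV (s : R) : s != 0 ->
  lam.-integrable setT (EFin \o gauss_rV s).
Proof.
move=> s0; have -> : @gauss_rV R d s = fun t => \prod_j ((normal_peak s^-1)^-1 *
    normal_pdf 0 s^-1 (t 0 j)).
  apply/funext => t; rewrite -prod_expR_gauss_rV; apply: eq_bigr => j _.
  rewrite normal_pdf0E ?invr_neq0// mulKf; last first.
    by rewrite gt_eqF// normal_peak_gt0// invr_neq0.
  by congr expR; field.
apply: (@integrable_prod_coord _ _ (fun _ r => (normal_peak s^-1)^-1 *
    normal_pdf 0 s^-1 r)) => j.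
exact: (integrableZl measurableT _ (integrable_normal_pdf 0 s^-1)).
Qed.

(** The squared modulus of the trigonometric sum [sum_j c_j exp (i t.u_j)]. *)
Definition trig_square N (u : 'I_N -> 'rV[R]_d) (c : 'rV[R]_N) (t : 'rV[R]_d) : R :=
  (\sum_j c 0 j * cos (dotmul t (u j))) ^+ 2 +
  (\sum_j c 0 j * sin (dotmul t (u j))) ^+ 2.

Lemma trig_square_ge0 N (u : 'I_N -> 'rV[R]_d) c t : 0 <= trig_square u c t.
Proof. by rewrite addr_ge0 ?sqr_ge0. Qed.

Lemma trig_squareE N (u : 'I_N -> 'rV[R]_d) (c : 'rV[R]_N) t :
  trig_square u c t =
  \sum_j \sum_k c 0 j * c 0 k * cos (dotmul t (u j - u k)).
Proof.
rewrite /trig_square !expr2 !big_distrlr -big_split /=.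
apply: eq_bigr => j _; rewrite -big_split /=; apply: eq_bigr => k _.
by rewrite dotmulBr cosB; ring.
Qed.

Lemma trig_square_eq0 N (u : 'I_N -> 'rV[R]_d) (c : 'rV[R]_N) :
  injective u -> (forall t, trig_square u c t = 0) -> c = 0.
Proof.
move=> iu Q0; apply/rowP => j; rewrite [RHS]mxE.
suff: (c 0 j)%:C = 0 :> R[i] by case.
apply: (@cis_independent _ u (index_enum 'I_N) (fun j => (c 0 j)%:C)) => //.
- exact: index_enum_uniq.
- move=> t; have /eqP := Q0 t; rewrite paddr_eq0 ?sqr_ge0// !sqrf_eq0.
  move=> /andP[/eqP C0 /eqP S0].
  apply/eqP; rewrite eq_complex !raddf_sum /=; apply/andP; split; apply/eqP.
    by rewrite -[RHS]C0; apply: eq_bigr => k _; rewrite mul0r subr0.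
  by rewrite -[RHS]S0; apply: eq_bigr => k _; rewrite mul0r addr0.
- exact: mem_index_enum.
Qed.

Lemma trig_square_continuous N (u : 'I_N -> 'rV[R]_d) (c : 'rV[R]_N) :
  continuous (trig_square u c).
Proof.
have cc v : continuous (fun t : 'rV[R]_d => cos (dotmul t v)).
  have := @cos_dotmul_continuous R d 0 v.
  by under eq_fun do rewrite add0r dotmulC.
have -> : trig_square u c =
    \sum_j \sum_k (fun t => c 0 j * c 0 k * cos (dotmul t (u j - u k))).
  apply/funext => t; rewrite trig_squareE fct_sumE; apply: eq_bigr => j _.
  by rewrite fct_sumE.
have cD (f g : 'rV[R]_d -> R) : continuous f -> continuous g -> continuous (f + g).
  by move=> cf cg t; exact: continuousD (cf t) (cg t).
have c0 : continuous (0 : 'rV[R]_d -> R) by exact: cst_continuous.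
elim/big_ind: _ => // j _; elim/big_ind: _ => // k _ t.
exact: continuousM (@cst_continuous _ _ _ t) (cc _ t).
Qed.

Lemma trig_square_bound N (u : 'I_N -> 'rV[R]_d) (c : 'rV[R]_N) t :
  `|trig_square u c t| <= \sum_j \sum_k `|c 0 j * c 0 k|.
Proof.
rewrite trig_squareE; apply: (le_trans (ler_norm_sum _ _ _)).
apply: ler_sum => j _; apply: (le_trans (ler_norm_sum _ _ _)).
by apply: ler_sum => k _; rewrite normrM ler_piMr// ler_norm_cos.
Qed.

(** If the integral were zero, the trigonometric sum would vanish almost
    everywhere. It then vanishes everywhere: by the approximate identity, the
    values of a continuous integrable function are limits of its Gaussian means.
    The factor [gauss_rV 1] makes the squared sum integrable. *)
Lemma Rintegral_mul_trig_square_gt0 (h : 'rV[R]_d -> R) N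
    (u : 'I_N -> 'rV[R]_d) (c : 'rV[R]_N) :
  lam.-integrable setT (EFin \o h) -> (forall t, 0 < h t) ->
  injective u -> c != 0 -> 0 < \int[lam]_t (h t * trig_square u c t).
Proof.
move=> ih h0 iu c0; pose M := \sum_j \sum_k `|c 0 j * c 0 k|.
have mQ : measurable_fun setT (trig_square u c).
  by apply: continuous_measurable_rV; exact: trig_square_continuous.
have ihQ : lam.-integrable setT (EFin \o (fun t => h t * trig_square u c t)).
  by apply: (@integrableM_bounded _ _ _ _ M) => //; exact: trig_square_bound.
have hQ0 t : 0 <= h t * trig_square u c t.
  by rewrite mulr_ge0 ?trig_square_ge0// ltW.
rewrite lt_neqAle Rintegral_ge0// andbT eq_sym; apply/negP => /eqP int0.
have aeQ : ae_eq lam setT (EFin \o (fun t => h t * trig_square u c t)) (cst 0%E).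
  apply/(ae_eq_integral_abs _ measurableT (measurable_int _ ihQ)).
  under eq_integral do rewrite /= ger0_norm//.
  by rewrite -[LHS]fineK ?(integrable_fin_num measurableT ihQ)//= [fine _]int0.
move/negP : c0; apply; apply/eqP/(trig_square_eq0 iu) => z.
pose f t := gauss_rV 1 t * trig_square u c t.
have cf : {for z, continuous f}.
  exact: continuousM (@gauss_rV_continuous R d 1 z) (@trig_square_continuous _ u c z).
have if_ : lam.-integrable setT (EFin \o f).
  apply: (@integrableM_bounded _ _ _ _ M) => //; first exact: trig_square_bound.
  by apply: integrable_gauss_rV; rewrite oner_neq0.
have f0 k : \int[lam]_y (f y * normal_rV_pdf z (k.+1%:R)^-1 y) = 0.
  rewrite /Rintegral (@ae_eq_integral _ _ _ lam setT (cst 0%E))//.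
  - by rewrite integral0.
  - apply/measurable_EFinP; apply: measurable_funM.
      by have /integrableP[/measurable_EFinP] := if_.
    exact: measurable_normal_rV_pdf.
  - apply: filterS aeQ => t hQt0 _; have := hQt0 Logic.I => -[] /eqP.
    by rewrite mulf_eq0 gt_eqF//= /f => /eqP ->; rewrite mulr0 mul0r.
have := cvg_normal_rV_pdf_Rintegral if_ cf; under eq_fun do rewrite f0.
move=> H; have /eqP : f z = 0 by apply/esym; exact: (cvg_unique _ (cvg_cst _) H).
by rewrite /f mulf_eq0 gt_eqF ?expR_gt0//= => /eqP.
Qed.

(** Fourier inversion turns the quadratic form into an integral against the
    positive transform. *)
Lemma positive_definite_of_transform (G h : 'rV[R]_d -> R) :
  continuous G -> (forall y, G (- y) = G y) ->
  lam.-integrable setT (EFin \o G) -> lam.-integrable setT (EFin \o h) ->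
  (forall t, 0 < h t) ->
  (forall t, \int[lam]_y (G y * cos (dotmul t y)) = h t) ->
  (forall t, \int[lam]_y (G y * sin (dotmul t y)) = 0) ->
  positive_definite G.
Proof.
move=> cG eG iG ih h0 hcos hsin; split=> // N u c iu c0.
have icos z : lam.-integrable setT (EFin \o (fun t => h t * cos (dotmul t z))).
  have := integrable_mul_cos z ih.
  by under [X in EFin \o X]funext do rewrite dotmulC.
have KE z : (fun t => \int[lam]_y (G y * cos (dotmul t (z - y)))) =
    (fun t => h t * cos (dotmul t z)).
  apply/funext => t.
  have E y : G y * cos (dotmul t (z - y)) = cos (dotmul t z) *
      (G y * cos (dotmul t y)) + sin (dotmul t z) * (G y * sin (dotmul t y)).
    by rewrite dotmulBr cosB; ring.
  under eq_Rintegral do rewrite E.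
  have i1 := integrable_mul_cos t iG; have i2 := integrable_mul_sin t iG.
  rewrite RintegralD//; last 2 first.
  - exact: (integrableZl measurableT (cos (dotmul t z)) i1).
  - exact: (integrableZl measurableT (sin (dotmul t z)) i2).
  by rewrite !RintegralZl// hcos hsin mulr0 addr0 mulrC.
have inv z : \int[lam]_t (h t * cos (dotmul t z)) = (2 * pi) ^+ d * G z.
  have := @Fourier_inversion R d G z iG (cG z); rewrite KE => /(_ (icos z)).
  exact.
have pi2 : 0 < (2 * pi : R) ^+ d by rewrite exprn_gt0// mulr_gt0// pi_gt0.
rewrite -(pmulr_rgt0 _ pi2).
suff -> : (2 * pi) ^+ d * (\sum_j \sum_k c 0 j * c 0 k * G (u j - u k)) =
    \int[lam]_t (h t * trig_square u c t).
  exact: Rintegral_mul_trig_square_gt0.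
have ijk j k : lam.-integrable setT (EFin \o (fun t =>
    c 0 j * c 0 k * (h t * cos (dotmul t (u j - u k))))).
  exact: (integrableZl measurableT (c 0 j * c 0 k) (icos (u j - u k))).
have sumE t : h t * trig_square u c t =
    \sum_j \sum_k c 0 j * c 0 k * (h t * cos (dotmul t (u j - u k))).
  rewrite trig_squareE mulr_sumr; apply: eq_bigr => j _; rewrite mulr_sumr.
  by apply: eq_bigr => k _; rewrite mulrCA.
under eq_Rintegral do rewrite sumE.
have ij j := (Rintegral_sum (index_enum 'I_N) (ijk j)).1.
rewrite (Rintegral_sum _ ij).2 mulr_sumr; apply: eq_bigr => j _.
rewrite (Rintegral_sum _ (ijk j)).2 mulr_sumr; apply: eq_bigr => k _.
by rewrite RintegralZl// inv mulrCA.
Qed.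

End positivity.

(** * Positive definite Green functions *)

Unset Implicit Arguments.
Local Open Scope complex_scope.

Theorem theorem4p1 (R : realType) (d : nat)
    (m : nat) (c : multi_index d -> R)
    (l_gt0 : forall x : 'rV[R]_d, 0 < diffop_symbol m c x)
    (l_inv_L1 : cintegrable (fun x : 'rV[R]_d => (diffop_symbol m c x)^-1))
    (G : 'rV[R]_d -> R)
    (G_cont : continuous G)
    (G_L1 : (lebesgue_rV d).-integrable setT (EFin \o G))
    (G_green : is_green (diffop m c) (L1_tempered G_L1))
    (G_even : forall x, G (- x) = G x) :
  positive_definite G /\
  forall x : 'rV[R]_d,
    fourier (fun y => (G y)%:C) x =
    ((2 * pi) `^ (- (d%:R / 2)))%:C * (diffop_symbol m c x)^-1.
Proof.
have pwE x : plane_wave_integral G x = (diffop_symbol m c x)^-1.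
  apply: (mulfI (lt0r_neq0 (l_gt0 x))).
  by rewrite (symbol_mul_green x G_green) mulfV ?lt0r_neq0.
split; last by move=> x; rewrite -pwE.
pose h t := complex.Re (diffop_symbol m c t)^-1.
have lV_gt0 t : 0 < (diffop_symbol m c t)^-1 by rewrite invr_gt0.
apply: (@positive_definite_of_transform _ _ G h) => //; first exact: l_inv_L1.1.
- by move=> t; have := lV_gt0 t; rewrite ltcE /= => /andP[].
- by move=> t; rewrite /h -pwE plane_wave_integralE.
- move=> t; have := lV_gt0 t; rewrite ltcE /= => /andP[/eqP + _].
  by rewrite -pwE plane_wave_integralE//= => /eqP; rewrite oppr_eq0 => /eqP.
Qed.
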